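(* If $f\in\mathbb{C}\{X,Y\}$ is a convenient power series without constant term, then $r_0(f)=\sum_{\tau}r_0(f_\tau)$, where the summation is over all quasi-tangents $\tau$ to the curve $f=0$.
   Context: $\mathbb{C}\{X,Y\}$ is the ring of convergent complex power series; $\mathbb{R}_+=[0,\infty)$. For nonzero $f$ without constant term, $r_0(f)$ is the number of irreducible factors of $f$ counted with multiplicities. For nonzero $f=\sum c_{\alpha\beta}X^\alpha Y^\beta$, the Newton diagram $\Delta(f)$ is the convex hull of $\{(\alpha,\beta):c_{\alpha\beta}\neq0\}+\mathbb{R}_+^2$; $f$ is convenient if the distances of $\Delta(f)$ to both coordinate axes are $0$ (equivalently neither $X$ nor $Y$ divides $f$). Let $n(f)$ be the set of compact one-dimensional faces of the boundary of $\Delta(f)$. For $S\in n(f)$ with vertices $(\alpha,\beta),(\alpha',\beta')$, $\alpha<\alpha'$, $\beta'<\beta$, put $|S|_1=\alpha'-\alpha$, $|S|_2=\beta-\beta'$, $r(S)=\gcd(|S|_1,|S|_2)$, $m_S=|S|_1/r(S)$, $n_S=|S|_2/r(S)$, $a(S)=\alpha$, $b(S)=\beta'$. The initial form is $\mathrm{in}(f,S)=\sum_{(\alpha,\beta)\in S}c_{\alpha\beta}X^\alpha Y^\beta=cX^{a(S)}Y^{b(S)}\prod_{i}(Y^{n_S}-a_iX^{m_S})^{d_i}$ with $c\ne0$ and $a_i\ne 0$ pairwise distinct. A binomial curve $\tau: Y^n-aX^m=0$ ($n,m>0$ coprime integers, $a\neq0$) is a quasi-tangent to $f=0$ (of tangential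 multiplicity $d$) if $Y^n-aX^m$ is a factor (of multiplicity $d$) of some $\mathrm{in}(f,S)$. Strict transform. For such a $\tau$, let $a^{1/n}=|a|^{1/n}\exp(i\theta/n)$ where $a=|a|\exp(i\theta)$, $0\le\theta<2\pi$. For nonzero $f$ without constant term, the strict transform $f_\tau\in\mathbb{C}\{X_\tau,Y_\tau\}$ is the unique power series such that $f(X_\tau^n,(a^{1/n}+Y_\tau)X_\tau^m)=X_\tau^kf_\tau(X_\tau,Y_\tau)$ for some integer $k>0$ and $f_\tau(0,Y_\tau)\neq0$. One has $f_\tau(0,0)=0$ if and only if $\tau$ is a quasi-tangent to $f=0$. *)

(* Defs.v *)
From HB Require Import structures.
From mathcomp Require Import all_boot all_order all_algebra.
From mathcomp Require Import complex.
From mathcomp Require Import all_classical all_reals all_analysis.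

Set Implicit Arguments.
Unset Strict Implicit.
Unset Printing Implicit Defensive.

Import Order.TTheory GRing.Theory Num.Theory.
Import numFieldNormedType.Exports.

Local Open Scope classical_set_scope.
Local Open Scope ring_scope.

(* K[[X, Y]]: the coefficient of X^i Y^j in f is [f i j]. *)
Record fps2 (K : Type) := Fps2 { coef2 :> nat -> nat -> K }.

HB.instance Definition _ (K : Type) := gen_eqMixin (fps2 K).
HB.instance Definition _ (K : Type) := gen_choiceMixin (fps2 K).

Lemma fps2P (K : Type) (f g : fps2 K) : (forall i j, f i j = g i j) -> f = g.
Proof.
case: f g => [f] [g] /= fg; congr Fps2.
by apply/funext => i; apply/funext => j.
Qed.

Section Fps2Zmodule.
Variable K : zmodType.
Implicit Types f g : fps2 K.

Definition fps2_zero : fps2 K := Fps2 (fun _ _ => 0).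
Definition fps2_opp f : fps2 K := Fps2 (fun i j => - f i j).
Definition fps2_add f g : fps2 K := Fps2 (fun i j => f i j + g i j).

Fact fps2_addA : associative fps2_add.
Proof. by move=> f g h; apply: fps2P => i j /=; rewrite addrA. Qed.
Fact fps2_addC : commutative fps2_add.
Proof. by move=> f g; apply: fps2P => i j /=; rewrite addrC. Qed.
Fact fps2_add0 : left_id fps2_zero fps2_add.
Proof. by move=> f; apply: fps2P => i j /=; rewrite add0r. Qed.
Fact fps2_addN : left_inverse fps2_zero fps2_opp fps2_add.
Proof. by move=> f; apply: fps2P => i j /=; rewrite addNr. Qed.

HB.instance Definition _ := GRing.isZmodule.Build (fps2 K)
  fps2_addA fps2_addC fps2_add0 fps2_addN.
End Fps2Zmodule.

Section Fps2Ring.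
Variable K : comNzRingType.
Implicit Types f g h : fps2 K.

Definition fps2_const (c : K) : fps2 K :=
  Fps2 (fun i j => if (i == 0%N) && (j == 0%N) then c else 0).

Definition fps2_mul f g : fps2 K :=
  Fps2 (fun i j => \sum_(k < i.+1) \sum_(l < j.+1) f k l * g (i - k)%N (j - l)%N).

Let trunc N f : {poly {poly K}} := \poly_(i < N) \poly_(j < N) f i j.

Let coef_trunc N f i j : (i < N)%N -> (j < N)%N -> (trunc N f)`_i`_j = f i j.
Proof. by move=> iN jN; rewrite coef_poly iN coef_poly jN. Qed.

Let coef_truncM N f g i j : (i < N)%N -> (j < N)%N ->
  (trunc N f * trunc N g)`_i`_j = fps2_mul f g i j.
Proof.
move=> iN jN; rewrite coefM coef_sum; apply: eq_bigr => k _.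
rewrite coefM; apply: eq_bigr => l _; rewrite !coef_trunc //.
- exact: leq_ltn_trans (leq_subr _ _) iN.
- exact: leq_ltn_trans (leq_subr _ _) jN.
- by apply: leq_ltn_trans iN; rewrite -ltnS.
- by apply: leq_ltn_trans jN; rewrite -ltnS.
Qed.

Let eq_coefM N (p p' q q' : {poly {poly K}}) :
  (forall i j, (i < N)%N -> (j < N)%N -> p`_i`_j = p'`_i`_j) ->
  (forall i j, (i < N)%N -> (j < N)%N -> q`_i`_j = q'`_i`_j) ->
  forall i j, (i < N)%N -> (j < N)%N -> (p * q)`_i`_j = (p' * q')`_i`_j.
Proof.
move=> pp qq i j iN jN; rewrite !coefM !coef_sum; apply: eq_bigr => k _.
rewrite !coefM; apply: eq_bigr => l _; rewrite pp ?qq //.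
- exact: leq_ltn_trans (leq_subr _ _) iN.
- exact: leq_ltn_trans (leq_subr _ _) jN.
- by apply: leq_ltn_trans iN; rewrite -ltnS.
- by apply: leq_ltn_trans jN; rewrite -ltnS.
Qed.

Fact fps2_mulA : associative fps2_mul.
Proof.
move=> f g h; apply: fps2P => i j; pose N := (maxn i j).+1.
have iN : (i < N)%N by rewrite ltnS leq_maxl.
have jN : (j < N)%N by rewrite ltnS leq_maxr.
rewrite -(coef_truncM _ _ iN jN) -(coef_truncM _ _ iN jN).
rewrite (eq_coefM (N := N) (p' := trunc N f) (q' := trunc N g * trunc N h)) //; last first.
  by move=> a b aN bN; rewrite coef_truncM // coef_trunc.
rewrite mulrA; apply: (eq_coefM (N := N)) => // a b aN bN.
by rewrite coef_truncM // coef_trunc.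
Qed.

Fact fps2_mulC : commutative fps2_mul.
Proof.
move=> f g; apply: fps2P => i j; pose N := (maxn i j).+1.
have iN : (i < N)%N by rewrite ltnS leq_maxl.
have jN : (j < N)%N by rewrite ltnS leq_maxr.
by rewrite -!(coef_truncM _ _ iN jN) mulrC.
Qed.

Fact fps2_mul1 : left_id (fps2_const 1) fps2_mul.
Proof.
move=> f; apply: fps2P => i j /=.
rewrite big_ord_recl big_ord_recl /= mul1r !subn0 !big1 ?addr0 //.
- by move=> k _; rewrite big1 // => l _ /=; rewrite mul0r.
- by move=> l _ /=; rewrite mul0r.
Qed.

Fact fps2_mulDl : left_distributive fps2_mul +%R.
Proof.
move=> f g h; apply: fps2P => i j /=; rewrite -big_split; apply: eq_bigr => k _.
by rewrite -big_split; apply: eq_bigr => l _; rewrite mulrDl.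
Qed.

Fact fps2_one_neq0 : fps2_const 1 != 0.
Proof.
by apply/eqP => /(congr1 (fun f : fps2 K => f 0%N 0%N)) /= /eqP; rewrite oner_eq0.
Qed.

HB.instance Definition _ := GRing.Zmodule_isComNzRing.Build (fps2 K)
  fps2_mulA fps2_mulC fps2_mul1 fps2_mulDl fps2_one_neq0.

Definition fps2X : fps2 K :=
  Fps2 (fun i j => if (i == 1%N) && (j == 0%N) then 1 else 0).
Definition fps2Y : fps2 K :=
  Fps2 (fun i j => if (i == 0%N) && (j == 1%N) then 1 else 0).

(* The substitution f(g, h), for g and h without constant term: then g^a h^b   *)
(* has order at least a + b, so the coefficient of X^i Y^j only involves the   *)
(* terms with a + b <= i + j.                                                  *)
Definition fps2_subst f g h : fps2 K :=
  Fps2 (fun i j =>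
    \sum_(a < (i + j).+1) \sum_(b < (i + j).+1) f a b * (g ^+ a * h ^+ b) i j).
End Fps2Ring.

Section Cps2.
Variable R : realType.

(* Absolute convergence at (r, r), hence on the polydisc |X|, |Y| <= r.        *)
Definition convergent2 (f : fps2 R[i]) : Prop :=
  exists2 r : R, 0 < r &
    summable [set: nat * nat]
      (fun p => (Normc.normc (f p.1 p.2) * r ^+ (p.1 + p.2))%:E).

Lemma normc_ge0 (z : R[i]) : 0 <= Normc.normc z.
Proof. by case: z => a b; apply: sqrtr_ge0. Qed.

Lemma esum_half (M : R) : 0 <= M ->
  (\esum_(i in [set: nat]) (M / 2 ^+ i)%:E = (2 * M)%:E)%E.
Proof.
move=> M0; rewrite -nneseries_esumT; last first.
  by move=> n; rewrite lee_fin divr_ge0 // exprn_ge0.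
have := @cvg_geometric_eseries_half R (2 * M) 0.
rewrite (_ : eseries _ = fun n => (\sum_(0 <= k < n) (M / 2 ^+ k)%:E)%E); last first.
  apply/funext => n; apply: eq_bigr => k _; congr _%:E.
  by rewrite addn1 natrX exprS invfM mulrACA divff ?mul1r // pnatr_eq0.
by rewrite expr0 divr1 => /cvg_lim <-.
Qed.

Lemma convergent2P (f : fps2 R[i]) : convergent2 f <->
  exists r M : R, 0 < r /\
    forall i j, Normc.normc (f i j) * r ^+ (i + j) <= M.
Proof.
split=> [[r r0 sf]|[r [M [r0 Mf]]]].
  pose t p := (Normc.normc (f p.1 p.2) * r ^+ (p.1 + p.2))%:E.
  have tfin : (\esum_(p in [set: nat * nat]) `|t p|)%E \is a fin_num.
    by rewrite -summableE.
  exists r, (fine (\esum_(p in [set: nat * nat]) `|t p|)%E); split => // i j.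
  rewrite -lee_fin fineK //; apply: esum_ge; exists [set (i, j)].
    by split; [exact: finite_set1|].
  by rewrite fsbig_set1 /t /= ger0_norm // mulr_ge0 ?normc_ge0 ?exprn_ge0 ?ltW.
have M0 : 0 <= M.
  by apply: le_trans (Mf 0%N 0%N); rewrite mulr_ge0 ?normc_ge0 ?exprn_ge0 ?ltW.
exists (r / 2); first by rewrite divr_gt0.
rewrite /summable.
have le1 : (\esum_(p in [set: nat * nat])
    `|(Normc.normc (f p.1 p.2) * (r / 2) ^+ (p.1 + p.2))%:E| <=
  \esum_(p in [set: nat * nat]) (M / 2 ^+ p.1 / 2 ^+ p.2)%:E)%E.
  apply: le_esum => -[i j] _ /=; rewrite lee_fin ger0_norm; last first.
    by rewrite mulr_ge0 ?normc_ge0 ?exprn_ge0 ?divr_ge0 // ltW.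
  rewrite exprMn exprVn mulrA -(mulrA M) -invfM -exprD.
  by rewrite ler_wpM2r // invr_ge0 exprn_ge0.
apply: le_lt_trans le1 _.
have -> : [set: nat * nat] = [set: nat] `*`` (fun=> [set: nat]).
  by apply/seteqP; split.
rewrite -(esum_esum (a := fun i j => (M / 2 ^+ i / 2 ^+ j)%:E)); last first.
  by move=> i j _ _; rewrite lee_fin !divr_ge0 // exprn_ge0.
rewrite (eq_esum (b := fun i => (2 * M / 2 ^+ i)%:E)); last first.
  by move=> i _; rewrite esum_half ?divr_ge0 ?exprn_ge0 // mulrA.
by rewrite esum_half ?ltry // mulr_ge0.
Qed.

Definition cps2_pred : {pred fps2 R[i]} := [pred f | `[< convergent2 f >]].

Lemma normc_sum (I : Type) (s : seq I) (F : I -> R[i]) :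
  Normc.normc (\sum_(i <- s) F i) <= \sum_(i <- s) Normc.normc (F i).
Proof.
elim: s => [|x s IH]; first by rewrite !big_nil Normc.normc0.
by rewrite !big_cons; apply: le_trans (le_normcD _ _) _; rewrite lerD2l.
Qed.

Fact cps2_subring : subring_closed cps2_pred.
Proof.
split=> [|f g|f g].
- apply/asboolP/convergent2P; exists 1, 1; split => // i j; rewrite expr1n mulr1 /=.
  by case: ifP; rewrite ?Normc.normc0 ?Normc.normc1.
- move=> /asboolP/convergent2P [r [M [r0 Mf]]].
  move=> /asboolP/convergent2P [s [N [s0 Ng]]].
  apply/asboolP/convergent2P; exists (Num.min r s), (M + N).
  have m0 : 0 < Num.min r s by rewrite lt_min r0.
  split => // i j /=.
  have le1 (a : R) k : Num.min r s <= a -> (Num.min r s) ^+ k <= a ^+ k.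
    by move=> ma; rewrite lerXn2r // nnegrE ?(le_trans (ltW m0) ma) ?ltW.
  apply: le_trans (ler_wpM2r _ (le_normcD _ _)) _; first by rewrite exprn_ge0 // ltW.
  rewrite normcN mulrDl lerD //.
    by apply: le_trans (Mf i j); rewrite ler_wpM2l ?normc_ge0 // le1 // ge_min lexx.
  by apply: le_trans (Ng i j); rewrite ler_wpM2l ?normc_ge0 // le1 // ge_min lexx orbT.
- move=> /asboolP/convergent2P [r [M [r0 Mf]]].
  move=> /asboolP/convergent2P [s [N [s0 Ng]]].
  apply/asboolP/convergent2P; pose m := Num.min r s; exists (m / 2), (M * N).
  have m0 : 0 < m by rewrite lt_min r0.
  have M0 : 0 <= M.
    by apply: le_trans (Mf 0%N 0%N); rewrite mulr_ge0 ?normc_ge0 ?exprn_ge0 ?ltW.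
  have le1 (a : R) k : m <= a -> m ^+ k <= a ^+ k.
    by move=> ma; rewrite lerXn2r // nnegrE ?(le_trans (ltW m0) ma) ?ltW.
  split => [|i j]; first by rewrite divr_gt0.
  rewrite exprMn exprVn mulrA ler_pdivrMr ?exprn_gt0 //.
  apply: le_trans (_ : \sum_(k < i.+1) \sum_(l < j.+1) M * N <= _); last first.
    rewrite !sumr_const !card_ord -mulrnA -[leLHS]mulr_natr ler_wpM2l //.
      by apply: mulr_ge0 => //; apply: le_trans (Ng 0%N 0%N);
         rewrite mulr_ge0 ?normc_ge0 ?exprn_ge0 ?ltW.
    by rewrite -natrX ler_nat mulnC expnD leq_mul // ltn_expl.
  apply: le_trans (ler_wpM2r _ (normc_sum _ _)) _; first by rewrite exprn_ge0 // ltW.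
  rewrite mulr_suml ler_sum // => k _.
  apply: le_trans (ler_wpM2r _ (normc_sum _ _)) _; first by rewrite exprn_ge0 // ltW.
  rewrite mulr_suml ler_sum // => l _.
  have -> : (i + j = (k + l) + ((i - k) + (j - l)))%N.
    by rewrite addnACA !subnKC // -ltnS.
  rewrite Normc.normcM exprD mulrACA ler_pM ?mulr_ge0 ?normc_ge0 ?exprn_ge0 ?(ltW m0) //.
    by apply: le_trans (Mf k l); rewrite ler_wpM2l ?normc_ge0 // le1 // ge_min lexx.
  by apply: le_trans (Ng (i - k)%N (j - l)%N);
     rewrite ler_wpM2l ?normc_ge0 // le1 // ge_min lexx orbT.
Qed.

HB.instance Definition _ :=
  GRing.isSubringClosed.Build (fps2 R[i]) cps2_pred cps2_subring.

(* C{X, Y}. *)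
Record cps2 := Cps2 { fps2_of :> fps2 R[i]; _ : fps2_of \in cps2_pred }.

HB.instance Definition _ := [isSub for fps2_of].
HB.instance Definition _ := [Choice of cps2 by <:].
HB.instance Definition _ := [SubChoice_isSubComNzRing of cps2 by <:].

Definition cps2_unit : {pred cps2} := [pred f | `[< exists g, g * f = 1 >]].

Definition cps2_inv (f : cps2) : cps2 :=
  if f \in cps2_unit then xget 0 [set g | g * f = 1] else f.

Fact cps2_mulVf : {in cps2_unit, left_inverse 1 cps2_inv *%R}.
Proof.
move=> f fU; rewrite /cps2_inv fU.
by case/asboolP: fU => g gf; apply: (xgetPex (P := [set g | g * f = 1]) 0); exists g.
Qed.

Fact cps2_unitP (f g : cps2) : g * f = 1 -> cps2_unit f.
Proof. by move=> gf; apply/asboolP; exists g. Qed.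

Fact cps2_inv_out : {in [predC cps2_unit], cps2_inv =1 id}.
Proof. by move=> f fU; rewrite /cps2_inv ifN. Qed.

HB.instance Definition _ := GRing.ComNzRing_hasMulInverse.Build cps2
  cps2_mulVf cps2_unitP cps2_inv_out.
End Cps2.

Section IrreducibleFactors.
Variable A : comUnitRingType.

(* Zero is excluded: 0 = 0 * 0. *)
Definition irreducible_elt (p : A) : Prop :=
  p \isn't a GRing.unit /\
  forall a b, p = a * b -> a \is a GRing.unit \/ b \is a GRing.unit.

(* The number of irreducible factors of f, counted with multiplicities; the    *)
(* value is meaningful when f has an essentially unique factorization.         *)
Definition r0 (f : A) : nat :=
  xget 0%N [set k | exists u : A, exists s : seq A,
    [/\ u \is a GRing.unit, (forall p, p \in s -> irreducible_elt p),
        f = u * \prod_(p <- s) p & k = size s]].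
End IrreducibleFactors.

Section NewtonDiagram.
Variable R : realType.
Implicit Types (f : cps2 R) (D S : set (R^o * R^o)).

Definition newton_diagram f : set (R^o * R^o) :=
  smallest (@convex_set R (R^o * R^o)%type)
    [set z | exists i j (u v : R),
       [/\ f i j != 0, 0 <= u, 0 <= v & z = (i%:R + u, j%:R + v)]].

(* The Newton diagram lies in the first quadrant, so its distances to the axes *)
(* are the infima of the coordinates.                                          *)
Definition convenient f : Prop :=
  inf [set z.1 | z in newton_diagram f] = 0 /\
  inf [set z.2 | z in newton_diagram f] = 0.

Definition face D S : Prop :=
  exists u v c : R,
    [/\ (u, v) != (0, 0), (forall z, D z -> c <= u * z.1 + v * z.2)
      & S = D `&` [set z | u * z.1 + v * z.2 = c]].

(* A face lies on a line, so it is one-dimensional as soon as it has two       *)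
(* distinct points.                                                            *)
Definition newton_faces f : set (set (R^o * R^o)) :=
  [set S | [/\ face (newton_diagram f) S, compact S
             & exists p q, [/\ S p, S q & p != q]]].

(* In {poly {poly _}}, the first variable is 'X and the second one is 'Y. *)
Definition initial_form f S : {poly {poly R[i]}} :=
  \sum_(p \in [set p : nat * nat | S (p.1%:R, p.2%:R)])
     (f p.1 p.2)%:P%:P * 'X^(p.1) * 'Y ^+ p.2.

(* The triple (n, m, a) stands for the curve Y^n - a X^m = 0. *)
Definition binomial_curve : Type := nat * nat * R[i].

Definition binomial_poly (t : binomial_curve) : {poly {poly R[i]}} :=
  let: (n, m, a) := t in 'Y ^+ n - a%:P%:P * 'X^m.

(* Divisibility is that of the ring C[X, Y]; the relation %| of polydiv would  *)
(* be pseudo-divisibility over C[Y].                                           *)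
Definition quasi_tangents f : set binomial_curve :=
  [set t | let: (n, m, a) := t in
     [/\ (0 < n)%N, (0 < m)%N, coprime n m, a != 0
       & exists2 S, newton_faces f S
         & exists q, initial_form f S = q * binomial_poly t]].
End NewtonDiagram.

Section StrictTransform.
Variable R : realType.
Local Open Scope complex_scope.

Definition cis (x : R) : R[i] := cos x +i* sin x.

Definition argument (a : R[i]) : R :=
  xget 0 [set x | 0 <= x < 2 * pi /\ a = (Normc.normc a)%:C * cis x].

Definition principal_root (n : nat) (a : R[i]) : R[i] :=
  (Normc.normc a `^ n%:R^-1)%:C * cis (argument a / n%:R).

Definition is_strict_transform (f : cps2 R) (t : binomial_curve R) (g : cps2 R) :
    Prop :=
  let: (n, m, a) := t in
  let X := fps2X R[i] in let Y := fps2Y R[i] in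
  (exists2 k : nat, (0 < k)%N &
     fps2_subst f (X ^+ n) ((fps2_const (principal_root n a) + Y) * X ^+ m) =
       X ^+ k * g)
  /\ exists j, g 0%N j != 0.

Definition strict_transform (f : cps2 R) (t : binomial_curve R) : cps2 R :=
  xget 0 (is_strict_transform f t).
End StrictTransform.

(* Main.v *)
(* Let tau be the curve Y^n = a X^m and let P be the pullback along
   (X, Y) |-> (X^n, (a^(1/n) + Y) X^m), so that P f = X^k f_tau.  As f |-> f_tau
   is multiplicative and the ring is factorial, everything reduces to an
   irreducible p divisible by neither X nor Y: there must be exactly one tau
   for which p_tau is not a unit, and that p_tau must be irreducible.

   Write d(h) for the order of h(0, Y).  The lowest quasi-homogeneous part of p
   is divisible by (Y^n - a X^m)^d(p_tau), hence n d(p_tau) <= d(p).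
   Conversely each h with d = d(h) > 0 comes from some H with H_tau ~ h and
   d(H) = n d, namely the characteristic polynomial over C{X^n} of the
   multiplication by (a^(1/n) + Y) X^m on C{X,Y}/(h).  If h divides p_tau, then
   H divides p: the remainder r of the Weierstrass division of p by H has
   h | r_tau, which contradicts n d(r_tau) <= d(r) < n d unless r = 0.
   So p ~ H for every non-unit divisor h of p_tau, which shows that p_tau is
   irreducible and that d(p) = n d(p_tau); the equality determines the slope and
   the coefficient of tau.  Such a tau exists by looking at the first edge of
   the Newton polygon of p. *)

Require Import Defs.
From HB Require Import structures.
From mathcomp Require Import all_boot all_order all_algebra.
From mathcomp Require Import complex.
From mathcomp Require Import all_classical all_reals all_analysis.
From mathcomp Require Import ring lra zify.

Set Implicit Arguments.
Unset Strict Implicit.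
Unset Printing Implicit Defensive.

Import Order.TTheory GRing.Theory Num.Theory.
Import numFieldNormedType.Exports.
Local Open Scope classical_set_scope.
Local Open Scope ring_scope.

(** The exponents of the lexicographically smallest monomial are additive under products. This gives
    the absence of zero divisors and the measure for factorization; for a pullback the two exponents
    are k and d(f_tau). The pullback is not surjective, so a factorization of p_tau cannot be lifted
    directly; the norm H is the substitute. That H_tau ~ h follows from the adjugate trick and a
    squeeze: the characteristic matrix kills the basis vector modulo h, so h divides P H and d <=
    d(H_tau), while n d(H_tau) <= d(H) <= n d. Hence the cofactor of h in P H is a power of X times
    a unit. The factor n in n d(p_tau) <= d(p) comes from coprimality: monomials of equal weight
    have Y-exponents congruent modulo n, so at X = 1 a quasi-homogeneous part is Y^c Q(Y^n), and a
    root al of multiplicity d makes al^n a root of Q of multiplicity d. Convergence is controlled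
    throughout by geometric bounds on the coefficients. *)

Section Coefficients.
Variable R : realType.
Implicit Types f g h : cps2 R.

Lemma cps2P f g : (forall i j, f i j = g i j) -> f = g.
Proof. by move=> fg; apply/val_inj/fps2P. Qed.

Lemma coef2D f g i j : (f + g) i j = f i j + g i j.
Proof. by []. Qed.

Lemma coef2B f g i j : (f - g) i j = f i j - g i j.
Proof. by []. Qed.

Lemma coef21 i j : (1 : cps2 R) i j = ((i == 0%N) && (j == 0%N))%:R.
Proof. by rewrite [LHS](_ : _ = if (i == 0%N) && (j == 0%N) then 1 else 0) //; case: ifP. Qed.

Lemma coef2M f g i j :
  (f * g) i j = \sum_(k < i.+1) \sum_(l < j.+1) f k l * g (i - k)%N (j - l)%N.
Proof. by []. Qed.

Lemma coef2_sum (I : Type) (s : seq I) (P : pred I) (F : I -> cps2 R) i j :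
  (\sum_(x <- s | P x) F x) i j = \sum_(x <- s | P x) F x i j.
Proof. exact: (big_morph (fun f : cps2 R => f i j)). Qed.

Lemma cps2_neq0P f : reflect (exists i j, f i j != 0) (f != 0).
Proof.
apply: (iffP idP) => [f0|[i [j]]]; last by apply: contraNneq => ->.
apply: contrapT => nf; move/eqP: f0; apply; apply: cps2P => i j.
by apply/eqP/negPn/negP => fij; apply: nf; exists i, j.
Qed.

Lemma normcD_le (x y : R[i]) : Normc.normc (x + y) <= Normc.normc x + Normc.normc y.
Proof. exact: le_normcD. Qed.

Definition bounded2 (c : nat -> nat -> R[i]) (M A : R) : Prop :=
  forall i j, Normc.normc (c i j) <= M * A ^+ (i + j).

(** Cauchy estimates, with [A] above the inverse of an admissible radius. Having [1 <= A] allows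
    exponents to be enlarged in later bounds. *)
Lemma cps2_bounded f : exists M A, [/\ 0 <= M, 1 <= A & bounded2 f M A].
Proof.
case: f => f /= /asboolP/convergent2P [r [M [r0 Mf]]].
have M0 : 0 <= M.
  by apply: le_trans (Mf 0%N 0%N); rewrite mulr_ge0 ?normc_ge0 ?exprn_ge0 ?ltW.
exists M, (1 + r^-1); split => // [|i j].
  by rewrite lerDl invr_ge0 ltW.
apply: (@le_trans _ _ (M * r^-1 ^+ (i + j))).
  by rewrite exprVn ler_pdivlMr ?exprn_gt0.
by rewrite ler_wpM2l // lerXn2r ?nnegrE ?addr_ge0 ?invr_ge0 ?(ltW r0) ?lerDr.
Qed.

Lemma bounded2_mem (c : nat -> nat -> R[i]) M A :
  0 < A -> bounded2 c M A -> Fps2 c \in @cps2_pred R.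
Proof.
move=> A0 cb; apply/asboolP/convergent2P; exists A^-1, M.
split=> [|i j]; first by rewrite invr_gt0.
by rewrite exprVn ler_pdivrMr ?exprn_gt0.
Qed.

Lemma cps2_of_bounded (c : nat -> nat -> R[i]) M A :
  0 < A -> bounded2 c M A -> exists f : cps2 R, forall i j, f i j = c i j.
Proof. by move=> A0 /(bounded2_mem A0) cP; exists (Cps2 cP). Qed.

(* Opaque, which keeps unification from comparing power series by unfolding. *)
Lemma cX_sig : {f : cps2 R | fps2_of f = fps2X R[i]}.
Proof.
suff fP : fps2X R[i] \in @cps2_pred R by exists (Cps2 fP).
apply: (@bounded2_mem _ 1 1) => // i j; rewrite expr1n mul1r.
by case: ifP; rewrite ?Normc.normc0 ?Normc.normc1.
Qed.
Definition cX : cps2 R := sval cX_sig.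

Lemma val_cX : fps2_of cX = fps2X R[i].
Proof. by rewrite (svalP cX_sig). Qed.

Lemma cY_sig : {f : cps2 R | fps2_of f = fps2Y R[i]}.
Proof.
suff fP : fps2Y R[i] \in @cps2_pred R by exists (Cps2 fP).
apply: (@bounded2_mem _ 1 1) => // i j; rewrite expr1n mul1r.
by case: ifP; rewrite ?Normc.normc0 ?Normc.normc1.
Qed.
Definition cY : cps2 R := sval cY_sig.

Lemma val_cY : fps2_of cY = fps2Y R[i].
Proof. by rewrite (svalP cY_sig). Qed.

Lemma cC_sig (c : R[i]) : {f : cps2 R | fps2_of f = fps2_const c}.
Proof.
suff fP : fps2_const c \in @cps2_pred R by exists (Cps2 fP).
apply: (@bounded2_mem _ (Normc.normc c) 1) => // i j; rewrite expr1n mulr1 /=.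
by case: ifP => // _; rewrite Normc.normc0 normc_ge0.
Qed.
Definition cC (c : R[i]) : cps2 R := sval (cC_sig c).

Lemma val_cC c : fps2_of (cC c) = fps2_const c.
Proof. by rewrite (svalP (cC_sig c)). Qed.

Lemma coef2CM c f i j : (cC c * f) i j = c * f i j.
Proof.
rewrite coef2M val_cC big_ord_recl big_ord_recl /= !subn0 !big1 ?addr0 // => [k _|k _].
  by rewrite big1 // => l _; rewrite mul0r.
by rewrite /= mul0r.
Qed.

Lemma coef2XM f i j : (cX * f) i j = if i is i'.+1 then f i' j else 0.
Proof.
have Z (k l : nat) : k != 1%N \/ l != 0%N -> cX k l = 0.
  move=> kl; rewrite val_cX /=; case: ifP => // /andP[/eqP E1 /eqP E2].
  by case: kl; rewrite ?E1 ?E2.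
rewrite coef2M; case: i => [|i].
  by rewrite big_ord1 big1 // => l _; rewrite Z ?mul0r //; left.
rewrite big_ord_recl big_ord_recl [X in X + _]big1 ?add0r; last first.
  by move=> l _; rewrite Z ?mul0r //; left.
rewrite [X in _ + X]big1 ?addr0; last first.
  by move=> k _; rewrite big1 // => l _; rewrite Z ?mul0r //; left.
rewrite big_ord_recl [X in _ + X]big1 ?addr0; last first.
  by move=> l _; rewrite Z ?mul0r //; right.
by rewrite val_cX /= mul1r subSS !subn0.
Qed.

Lemma coef2XnM n f i j : (cX ^+ n * f) i j = if (n <= i)%N then f (i - n)%N j else 0.
Proof.
elim: n f i => [|n IH] f i; first by rewrite mul1r subn0.
rewrite exprSr -mulrA IH; case: ltngtP => ni.
- by rewrite coef2XM; case E: (i - n)%N => [|k]; [lia|rewrite (_ : (i - n.+1 = k)%N) //; lia].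
- by [].
- by rewrite coef2XM (_ : (i - n = 0)%N) //; lia.
Qed.

Lemma coef2YM f i j : (cY * f) i j = if j is j'.+1 then f i j' else 0.
Proof.
have Z (k l : nat) : k != 0%N \/ l != 1%N -> cY k l = 0.
  move=> kl; rewrite val_cY /=; case: ifP => // /andP[/eqP E1 /eqP E2].
  by case: kl; rewrite ?E1 ?E2.
rewrite coef2M big_ord_recl [X in _ + X]big1 ?addr0; last first.
  by move=> k _; rewrite big1 // => l _; rewrite Z ?mul0r //; left.
case: j => [|j]; first by rewrite big_ord1 Z ?mul0r //; right.
rewrite big_ord_recl Z ?mul0r ?add0r; last by right.
rewrite big_ord_recl [X in _ + X]big1 ?addr0; last first.
  by move=> l _; rewrite Z ?mul0r //; right.
by rewrite val_cY /= mul1r subSS !subn0.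
Qed.

Lemma coef2YnM n f i j : (cY ^+ n * f) i j = if (n <= j)%N then f i (j - n)%N else 0.
Proof.
elim: n f j => [|n IH] f j; first by rewrite mul1r subn0.
rewrite exprSr -mulrA IH; case: ltngtP => nj.
- by rewrite coef2YM; case E: (j - n)%N => [|k]; [lia|rewrite (_ : (j - n.+1 = k)%N) //; lia].
- by [].
- by rewrite coef2YM (_ : (j - n = 0)%N) //; lia.
Qed.

(** Shifting the rows by [n] keeps a geometric bound: the extra factor [A ^+ n] goes into the
    constant. *)
Lemma divXn n f : (forall i j, (i < n)%N -> f i j = 0) -> exists g, f = cX ^+ n * g.
Proof.
move=> f0; have [M [A [M0 A1 fb]]] := cps2_bounded f.
have A0 : 0 < A by apply: lt_le_trans A1.
have [|g gE] := @cps2_of_bounded (fun i j => f (i + n)%N j) (M * A ^+ n) A A0.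
  by move=> i j; apply: le_trans (fb _ _) _; rewrite addnAC [(_ + n)%N]addnC exprD mulrA.
exists g; apply: cps2P => i j; rewrite coef2XnM; case: ifP => ni.
  by rewrite gE subnK.
by apply: f0; lia.
Qed.

Lemma divYn n f : (forall i j, (j < n)%N -> f i j = 0) -> exists g, f = cY ^+ n * g.
Proof.
move=> f0; have [M [A [M0 A1 fb]]] := cps2_bounded f.
have A0 : 0 < A by apply: lt_le_trans A1.
have [|g gE] := @cps2_of_bounded (fun i j => f i (j + n)%N) (M * A ^+ n) A A0.
  by move=> i j; apply: le_trans (fb _ _) _; rewrite addnA [(_ + n)%N]addnC exprD mulrA.
exists g; apply: cps2P => i j; rewrite coef2YnM; case: ifP => nj.
  by rewrite gE subnK.
by apply: f0; lia.
Qed.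
End Coefficients.
Arguments cX {R}.
Arguments cY {R}.

(** * The smallest monomial as an additive valuation *)

Section LexicographicOrder.
Variable R : realType.
Implicit Types f g h : cps2 R.

(* [X^k Y^d] is the lexicographically smallest monomial of [f]. *)
Definition lexord f k d : Prop :=
  [/\ f k d != 0, forall i j, (i < k)%N -> f i j = 0
    & forall j, (j < d)%N -> f k j = 0].

Lemma lexord_ex f : f != 0 -> exists k d, lexord f k d.
Proof.
move=> /cps2_neq0P fne.
have Pk : exists k, `[< exists j, f k j != 0 >].
  by case: fne => i [j fij]; exists i; apply/asboolP; exists j.
case: (ex_minnP Pk) => k /asboolP Pd kmin.
case: (ex_minnP Pd) => d fkd dmin; exists k, d; split => // [i j ik|j jd].
  apply/eqP/negPn/negP => fij.
  have : (k <= i)%N by apply: kmin; apply/asboolP; exists j.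
  by rewrite leqNgt ik.
by apply/eqP/negPn/negP => /dmin; rewrite leqNgt jd.
Qed.

Lemma lexord_neq0 f k d : lexord f k d -> f != 0.
Proof. by case=> fkd _ _; apply/cps2_neq0P; exists k, d. Qed.

Lemma lexord_uniq f k d k' d' : lexord f k d -> lexord f k' d' -> k = k' /\ d = d'.
Proof.
move=> [f1 f2 f3] [g1 g2 g3].
have E : k = k'.
  case: (ltngtP k k') => // kk; first by rewrite g2 ?eqxx in f1.
  by rewrite f2 ?eqxx in g1.
subst k'; split=> //; case: (ltngtP d d') => // dd; first by rewrite g3 ?eqxx in f1.
by rewrite f3 ?eqxx in g1.
Qed.

(** In the coefficient of [X^(k + k') Y^(d + d')], every product other than [f k d * g k' d']
    involves a monomial of [f] or of [g] below its smallest one, hence vanishes. *)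
Lemma lexordM f g k d k' d' :
  lexord f k d -> lexord g k' d' -> lexord (f * g) (k + k') (d + d').
Proof.
move=> [f1 f2 f3] [g1 g2 g3].
have Z i j a b : (i + a < k + k')%N || (i + a == k + k')%N && (j + b < d + d')%N ->
    f i j * g a b = 0.
  case: (ltngtP i k) => ik H; first by rewrite f2 ?mul0r.
    by rewrite [g _ _]g2 ?mulr0 //; lia.
  subst i; case: (ltngtP a k') => ak; first by rewrite g2 ?mulr0.
    by lia.
  subst a; case: (ltnP j d) => jd; first by rewrite f3 ?mul0r.
  by rewrite g3 ?mulr0 //; lia.
split=> [|i j ik|j jd].
- rewrite coef2M (bigD1 (inord k)) //= (bigD1 (inord d)) //=.
  rewrite !inordK ?ltnS ?leq_addr // !addKn big1 ?addr0 => [|l ld]; last first.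
    have {ld} ld : val l != d.
      by apply: contraNneq ld => le; apply/eqP/val_inj; rewrite /= inordK ?ltnS ?leq_addr.
    case: (ltngtP l d) ld => // ld _; first by rewrite f3 ?mul0r.
    by rewrite (g3 (_ - _)%N) ?mulr0 //; have := ltn_ord l; lia.
  rewrite big1 ?addr0 ?mulf_neq0 // => l lk.
  have {lk} lk : val l != k.
    by apply: contraNneq lk => le; apply/eqP/val_inj; rewrite /= inordK ?ltnS ?leq_addr.
  rewrite big1 // => j _.
  case: (ltngtP l k) lk => // lk _; first by rewrite f2 ?mul0r.
  by rewrite (g2 (_ - _)%N) ?mulr0 //; have := ltn_ord l; lia.
- rewrite coef2M big1 // => a _; rewrite big1 // => b _; apply: Z.
  by have := ltn_ord a; rewrite ltnS => ai; apply/orP; left; lia.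
- rewrite coef2M big1 // => a _; rewrite big1 // => b _; apply: Z.
  by have := ltn_ord a; have := ltn_ord b; rewrite !ltnS => bj ak; lia.
Qed.

Lemma lexordX k : lexord (cX ^+ k) k 0.
Proof.
have E i j : (cX ^+ k : cps2 R) i j = ((i == k) && (j == 0%N))%:R.
  rewrite -[cX ^+ k]mulr1 coef2XnM coef21; case: ltngtP => //= ki.
    by rewrite subn_eq0 leqNgt ki.
  by rewrite ki subnn eqxx.
split=> [|i j ik|//]; first by rewrite E !eqxx oner_neq0.
by rewrite E ltn_eqF.
Qed.

Lemma cps2_mulf_neq0 f g : f != 0 -> g != 0 -> f * g != 0.
Proof.
by move=> /lexord_ex[k [d fo]] /lexord_ex[k' [d' go]]; exact: lexord_neq0 (lexordM fo go).
Qed.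

Lemma cps2_mulfI f : f != 0 -> injective ( *%R f).
Proof.
move=> f0 g h /eqP; rewrite -subr_eq0 -mulrBr => E.
by apply/eqP; rewrite -subr_eq0; apply: contraTT E => gh; apply: cps2_mulf_neq0.
Qed.

Lemma lexord_split f k d : lexord f k d -> exists2 g, f = cX ^+ k * g & lexord g 0 d.
Proof.
move=> [f1 f2 f3]; have [g fE] := divXn f2; exists g => //.
have gE j : g 0%N j = f k j by rewrite fE coef2XnM leqnn subnn.
by split=> [|//|j jd]; rewrite gE // f3.
Qed.

Lemma lexord_Mr f g k d k' d' : lexord f k d -> lexord (f * g) k' d' ->
  [/\ (k <= k')%N, (d <= d')%N & lexord g (k' - k) (d' - d)].
Proof.
move=> fo fgo.
have g0 : g != 0 by apply: contraNneq (lexord_neq0 fgo) => ->; rewrite mulr0.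
have [a [b go]] := lexord_ex g0.
have [-> ->] := lexord_uniq fgo (lexordM fo go).
by rewrite !leq_addr !addKn.
Qed.

Lemma lexord0 f d : f 0%N d != 0 -> exists2 d', (d' <= d)%N & lexord f 0 d'.
Proof.
move=> f0; have [] := @ex_minnP (fun d => f 0%N d != 0); first by exists d.
move=> e e0 emin; exists e; first exact: emin.
by split=> // j je; apply/eqP/negPn/negP => /emin; rewrite leqNgt je.
Qed.
End LexicographicOrder.

(** * Weierstrass division *)

Section StrongRecursion.
Variables (T : Type) (x0 : T) (F : nat -> (nat -> T) -> T).

(** Course-of-values recursion: the values found so far are kept in a list, which [nth x0] presents
    as a function equal to [x0] past the end; [F_ext] says that [F] does not look there. *)
Fixpoint rec_prefix n : seq T :=
  if n is n'.+1 then rcons (rec_prefix n') (F n' (nth x0 (rec_prefix n'))) else [::].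

Definition strong_rec n : T := F n (nth x0 (rec_prefix n)).

Hypothesis F_ext : forall n u v, (forall k, (k < n)%N -> u k = v k) -> F n u = F n v.

Lemma strong_recE n : strong_rec n = F n strong_rec.
Proof.
have sz m : size (rec_prefix m) = m by elim: m => //= m IH; rewrite size_rcons IH.
have nthE m k : (k < m)%N -> nth x0 (rec_prefix m) k = strong_rec k.
  elim: m => // m IH km /=; rewrite nth_rcons sz; move: km; rewrite ltnS leq_eqVlt.
  by case: ltngtP => //= [km _|-> _]; first exact: IH.
by rewrite {1}/strong_rec; apply: F_ext => k; apply: nthE.
Qed.
End StrongRecursion.

Section Geometric.
Variables (R : realType) (x y : R).
Hypothesis y0 : 0 <= y.

(** The left side equals [y * (x ^+ n - y ^+ n)]. Taking [x - y] large makes the convolution of two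
    geometric sequences a small multiple of [x ^+ n]. *)
Lemma geometric_lt n :
  (x - y) * \sum_(l < n) x ^+ l * y ^+ (n - l) <= y * x ^+ n.
Proof.
elim: n => [|n IH]; first by rewrite big_ord0 mulr0 mulr1.
rewrite big_ord_recr /= subSn // subnn expr1.
rewrite (_ : \sum_(i < n) _ = y * \sum_(l < n) x ^+ l * y ^+ (n - l)); last first.
  rewrite mulr_sumr; apply: eq_bigr => l _.
  by rewrite subSn 1?ltnW // exprS mulrCA.
rewrite mulrDr mulrCA exprS.
apply: le_trans (_ : y * (y * x ^+ n) + (x - y) * (x ^+ n * y) <= _).
  by rewrite lerD2r ler_wpM2l.
by rewrite le_eqVlt; apply/orP; left; apply/eqP; ring.
Qed.

Lemma geometric_le n :
  (x - y) * \sum_(l < n.+1) x ^+ l * y ^+ (n - l) <= x ^+ n.+1.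
Proof.
rewrite big_ord_recr /= subnn mulr1 mulrDr exprS.
apply: le_trans (_ : y * x ^+ n + (x - y) * x ^+ n <= _).
  by rewrite lerD2r geometric_lt.
by rewrite le_eqVlt; apply/orP; left; apply/eqP; ring.
Qed.
End Geometric.

Section WeierstrassDivision.
Variable R : realType.
Variables (f g : cps2 R) (d : nat).
Hypothesis g_ord : lexord g 0 d.

(** In the coefficient of [X^i Y^(j + d)] of [q * g], the terms with [q i l], [l > j], vanish
    because [g] has order [d] in row 0. What accompanies [q i j * g 0 d] is [tail], from earlier
    rows, and [head], from earlier entries of the same row. As [tail] reads columns up to [j + d],
    whole rows must be known first: hence two nested recursions. *)
Let tail i j (q : nat -> nat -> R[i]) : R[i] :=
  \sum_(k < i) \sum_(l < (j + d).+1) q k l * g (i - k)%N (j + d - l)%N.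

Let head j (row : nat -> R[i]) : R[i] :=
  \sum_(l < j) row l * g 0%N (j + d - l)%N.

Let next_row i (q : nat -> nat -> R[i]) : nat -> R[i] :=
  strong_rec 0 (fun j row => (g 0%N d)^-1 * (f i (j + d)%N - tail i j q - head j row)).

Let quotient : nat -> nat -> R[i] := strong_rec (fun=> 0) next_row.

Let quotientE i j : g 0%N d * quotient i j =
  f i (j + d)%N - tail i j quotient - head j (quotient i).
Proof.
have rowE i' q j' : next_row i' q j' =
    (g 0%N d)^-1 * (f i' (j' + d)%N - tail i' j' q - head j' (next_row i' q)).
  rewrite {1}/next_row strong_recE // => n u v uv; congr (_ * (_ - _)).
  by apply: eq_bigr => l _; rewrite uv.
have -> : quotient i = next_row i quotient.
  rewrite {1}/quotient strong_recE // => n u v uv; congr (strong_rec 0 _).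
  apply/funext => j'; apply/funext => row; congr (_ * (_ - _ - _)).
  by apply: eq_bigr => k _; rewrite uv.
by rewrite rowE mulVKf //; case: g_ord.
Qed.

Let quotient_mul i j (q : cps2 R) : (forall i j, q i j = quotient i j) ->
  (q * g) i (j + d)%N = f i (j + d)%N.
Proof.
move=> qE; have [g1 g2 g3] := g_ord.
rewrite coef2M big_ord_recr /= subnn.
rewrite (_ : \sum_(k < i) _ = tail i j quotient); last first.
  by apply: eq_bigr => k _; apply: eq_bigr => l _; rewrite qE.
rewrite -(big_mkord xpredT (fun l => q i l * g 0%N (j + d - l)%N)) 
  (@big_cat_nat _ _ _ j) //=; last by lia.
rewrite big_mkord [X in _ + (X + _)](_ : _ = head j (quotient i)); last first.
  by apply: eq_bigr => l _; rewrite qE.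
rewrite big_ltn ?ltnS ?leq_addr // addKn big_nat big1 => [|l /andP[jl lj]]; last first.
  by rewrite g3 ?mulr0 //; lia.
by rewrite qE addr0 [_ * g _ _]mulrC quotientE; ring.
Qed.

(** The bound [C * A ^+ i * B ^+ j] is proved along the recursion, with separate growth rates in X
    and Y: the term from [f] takes one half of it, [tail] and [head] one quarter each. *)
Let quotient_bounded : exists C A, 0 < A /\ bounded2 quotient C A.
Proof.
have [M [G [M0 G1 gb]]] := cps2_bounded g.
have [N [F [N0 F1 fb]]] := cps2_bounded f.
have [g1 g2 g3] := g_ord.
have G0 : 0 <= G by apply: le_trans G1.
have F0 : 0 <= F by apply: le_trans F1.
pose D := Normc.normc (g 0%N d)^-1.
have D0 : 0 <= D by apply: normc_ge0.
pose eB := 4 * D * M * G ^+ d * G.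
have eB0 : 0 <= eB by rewrite !mulr_ge0 ?exprn_ge0.
pose B := G + F + 1 + eB.
have B0 : 0 <= B by rewrite !addr_ge0.
(* [tail] reaches [d] columns further, which costs [B ^+ d.+1]; so [A] is chosen after [B] and
   absorbs that factor. *)
pose eA := 4 * D * M * G * B ^+ d.+1.
have eA0 : 0 <= eA by rewrite !mulr_ge0 ?exprn_ge0.
pose A := G + F + 1 + eA.
have A0 : 0 <= A by rewrite !addr_ge0.
pose C := 2 * D * N * F ^+ d.
have C0 : 0 <= C by rewrite !mulr_ge0 ?exprn_ge0.
suff qb i j : Normc.normc (quotient i j) <= C * A ^+ i * B ^+ j.
  exists C, (A + B); split=> [|i j]; first by rewrite /A /B; lra.
  apply: le_trans (qb i j) _; rewrite exprD mulrA.
  rewrite ler_pM ?mulr_ge0 ?exprn_ge0 //.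
    by rewrite ler_wpM2l // lerXn2r ?nnegrE ?addr_ge0 // lerDl.
  by rewrite lerXn2r ?nnegrE ?addr_ge0 // lerDr.
have G_gt0 : 0 < G by apply: lt_le_trans G1.
elim/ltn_ind: i j => i IHi; elim/ltn_ind => j IHj.
pose S1 := \sum_(k < i) A ^+ k * G ^+ (i - k).
pose S2 := \sum_(l < (j + d).+1) B ^+ l * G ^+ (j + d - l).
pose S3 := \sum_(l < j) B ^+ l * G ^+ (j - l).
have S10 : 0 <= S1 by apply: sumr_ge0 => k _; rewrite mulr_ge0 ?exprn_ge0.
have S20 : 0 <= S2 by apply: sumr_ge0 => k _; rewrite mulr_ge0 ?exprn_ge0.
have S30 : 0 <= S3 by apply: sumr_ge0 => k _; rewrite mulr_ge0 ?exprn_ge0.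
have S1le : 4 * D * M * B ^+ d.+1 * S1 <= A ^+ i.
  rewrite -(ler_pM2l G_gt0); apply: le_trans _ (@geometric_lt _ A _ G0 i).
  rewrite (_ : G * _ = eA * S1); last by rewrite /eA; ring.
  by rewrite ler_wpM2r // /A; lra.
have S2le : S2 <= B ^+ j * B ^+ d.+1.
  rewrite -exprD addnS; apply: le_trans _ (@geometric_le _ B _ G0 (j + d)).
  by rewrite -[leLHS]mul1r ler_wpM2r // /B; lra.
have S3le : 4 * D * M * G ^+ d * S3 <= B ^+ j.
  rewrite -(ler_pM2l G_gt0); apply: le_trans _ (@geometric_lt _ B _ G0 j).
  rewrite (_ : G * _ = eB * S3); last by rewrite /eB; ring.
  by rewrite ler_wpM2r // /B; lra.
have tail_le : Normc.normc (tail i j quotient) <= C * M * (S1 * S2).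
  apply: le_trans (normc_sum _ _) _; rewrite mulr_suml mulr_sumr ler_sum // => k _.
  apply: le_trans (normc_sum _ _) _; rewrite mulr_sumr mulr_sumr ler_sum // => l _.
  rewrite Normc.normcM.
  apply: le_trans (ler_pM (normc_ge0 _) (normc_ge0 _) (IHi _ (ltn_ord k) _) (gb _ _)) _.
  by rewrite exprD le_eqVlt; apply/orP; left; apply/eqP; ring.
have head_le : Normc.normc (head j (quotient i)) <= C * A ^+ i * (M * G ^+ d * S3).
  apply: le_trans (normc_sum _ _) _; rewrite !mulr_sumr ler_sum // => l _.
  rewrite Normc.normcM.
  apply: le_trans (ler_pM (normc_ge0 _) (normc_ge0 _) (IHj _ (ltn_ord l)) (gb _ _)) _.
  rewrite add0n addnC -addnBA 1?ltnW // exprD.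
  by rewrite le_eqVlt; apply/orP; left; apply/eqP; ring.
have f_le : N * F ^+ (i + (j + d)) <= N * F ^+ d * (A ^+ i * B ^+ j).
  rewrite !exprD (_ : N * _ = N * F ^+ d * (F ^+ i * F ^+ j)); last by ring.
  rewrite ler_wpM2l ?mulr_ge0 ?exprn_ge0 // ler_pM ?exprn_ge0 //.
    by rewrite lerXn2r ?nnegrE // /A; lra.
  by rewrite lerXn2r ?nnegrE // /B; lra.
have -> : quotient i j =
    (g 0%N d)^-1 * (f i (j + d)%N - tail i j quotient - head j (quotient i)).
  by rewrite -quotientE mulKf.
rewrite Normc.normcM -/D.
have norm_le : Normc.normc (f i (j + d)%N - tail i j quotient - head j (quotient i)) <=
    N * F ^+ d * (A ^+ i * B ^+ j) + C * M * (S1 * S2) + C * A ^+ i * (M * G ^+ d * S3).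
  apply: le_trans (le_normcD _ _) _; rewrite normcN lerD //.
  apply: le_trans (le_normcD _ _) _; rewrite normcN lerD //.
  exact: le_trans (fb _ _) f_le.
apply: le_trans (ler_wpM2l D0 norm_le) _.
have S12le : 4 * D * M * S1 * S2 <= A ^+ i * B ^+ j.
  apply: le_trans (_ : 4 * D * M * S1 * (B ^+ j * B ^+ d.+1) <= _).
    by rewrite ler_wpM2l // !mulr_ge0.
  rewrite (_ : _ * _ = 4 * D * M * B ^+ d.+1 * S1 * B ^+ j); last by ring.
  by rewrite ler_wpM2r // exprn_ge0.
have := ler_wpM2l C0 S12le.
have := ler_wpM2l (mulr_ge0 C0 (exprn_ge0 i A0)) S3le.
have -> : D * (N * F ^+ d * (A ^+ i * B ^+ j) + C * M * (S1 * S2) +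
    C * A ^+ i * (M * G ^+ d * S3)) =
  C * A ^+ i * B ^+ j / 2 + C * (4 * D * M * S1 * S2) / 4 +
    C * A ^+ i * (4 * D * M * G ^+ d * S3) / 4.
  by rewrite /C; field.
by rewrite [C * (A ^+ i * B ^+ j)]mulrA; lra.
Qed.

Lemma weierstrass_division :
  exists q r : cps2 R, f = q * g + r /\ forall i j, (d <= j)%N -> r i j = 0.
Proof.
have [C [A [A0 qb]]] := quotient_bounded.
have [q qE] := cps2_of_bounded A0 qb.
exists q, (f - q * g); split; first by rewrite addrC subrK.
move=> i j /subnK <-; rewrite coef2B quotient_mul // subrr //.
Qed.
End WeierstrassDivision.

(** * Factoriality *)

Section UniqueFactorization.
Variable R : realType.
Implicit Types f g h p : cps2 R.

Definition divides p f : Prop := exists c, f = p * c.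

Lemma cps2_unitE f : (f \is a GRing.unit) = (f 0%N 0%N != 0).
Proof.
apply/idP/idP => [/unitrPr[g /(congr1 (fun h : cps2 R => h 0%N 0%N))]|f0].
  rewrite coef2M !big_ord1 coef21 /=; apply: contra_eq_neq => ->.
  by rewrite mul0r eq_sym oner_neq0.
(* Dividing 1 by [f] with [d = 0] leaves no remainder, so the quotient is a convergent inverse. *)
have fo : lexord f 0 0 by split.
have [q [r [E r0]]] := weierstrass_division 1 fo.
apply/unitrPr; exists q; rewrite E [q * f]mulrC (_ : r = 0) ?addr0 //.
by apply: cps2P => i j; rewrite r0.
Qed.

Lemma cps2_unit_lexord f : f \is a GRing.unit <-> lexord f 0 0.
Proof. by rewrite cps2_unitE; split=> [f0|[]]; first split. Qed.

Lemma cps2_unit_neq0 f : f \is a GRing.unit -> f != 0.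
Proof. by move=> /cps2_unit_lexord/lexord_neq0. Qed.

Lemma irreducible_neq0 p : irreducible_elt p -> p != 0.
Proof.
move=> [pU pI]; apply: contraPneq pI => -> /(_ 0 0); rewrite mulr0 => /(_ erefl).
by rewrite cps2_unitE eqxx => -[].
Qed.

Lemma cX_nunit : (cX : cps2 R) \isn't a GRing.unit.
Proof. by rewrite cps2_unitE val_cX /= eqxx. Qed.

Lemma dividesXn f n : divides (cX ^+ n) f <-> forall i j, (i < n)%N -> f i j = 0.
Proof.
split=> [[g ->] i j ik|/divXn //]; rewrite coef2XnM leqNgt ik //.
Qed.

(** As [p] has order 0 in X, the whole factor [X^e] sits in [z] and can be cancelled. *)
Lemma lexord_dividesXn p g z e d : lexord p 0 d -> cX ^+ e * g = p * z ->
  divides p g.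
Proof.
move=> po E; have [->|g0] := eqVneq g 0; first by exists 0; rewrite mulr0.
have [k [d' go]] := lexord_ex g0.
have := lexordM (lexordX R e) go; rewrite E => pzo.
have [_ _ [_ zo _]] := lexord_Mr po pzo.
have [z' zE] : divides (cX ^+ e) z.
  by apply/dividesXn => i j ie; apply: zo; rewrite subn0 ltn_addr.
exists z'; apply: (@cps2_mulfI _ (cX ^+ e)); first exact: lexord_neq0 (lexordX R e).
by rewrite E zE mulrCA.
Qed.

(* Let [J] be the set of the [h] such that [X^e h] lies in the ideal [(p, a)] *)
(* for some [e].  Weierstrass division shows that [J] is generated by any of  *)
(* its elements of minimal order in [Y] at [X = 0].                           *)
Lemma irreducible_prime p a b :
  irreducible_elt p -> divides p (a * b) -> divides p a \/ divides p b.
Proof.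
move=> pI [c abE]; have [pU pF] := pI.
have p0 := irreducible_neq0 pI.
have [k [d po]] := lexord_ex p0.
have [k0|k0] := posnP k; last first.
  have [_ pk _] := po.
  have [q pE] : divides (cX ^+ 1) p.
    by apply/dividesXn => i j i1; apply: pk; lia.
  (* Here [p] is X up to a unit. A series not divisible by [p] then has order 0 in X, and so would
     the product [a * b]. *)
  have qU : q \is a GRing.unit.
    by case: (pF _ _ pE) => //; rewrite expr1 (negPf cX_nunit).
  have pX f : f != 0 -> ~ divides p f -> exists d, lexord f 0 d.
    move=> f0 npf; have [l [e fo]] := lexord_ex f0.
    have [l0|l0] := posnP l; first by exists e; rewrite -l0.
    have [_ fl _] := fo; have [w fE] : divides (cX ^+ 1) f.
      by apply/dividesXn => i j i1; apply: fl; lia.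
    by case: npf; exists (q^-1 * w); rewrite pE -mulrA mulVKr.
  case: (pselect (divides p a)) => [|npa]; first by left.
  case: (pselect (divides p b)) => [|npb]; first by right.
  have a0 : a != 0 by apply: contra_notN npa => /eqP ->; exists 0; rewrite mulr0.
  have b0 : b != 0 by apply: contra_notN npb => /eqP ->; exists 0; rewrite mulr0.
  have [d1 ao] := pX _ a0 npa; have [d2 bo] := pX _ b0 npb.
  have := lexordM ao bo; rewrite abE => pco.
  by have [] := lexord_Mr po pco; lia.
subst k; case: (pselect (divides p a)) => [|npa]; [by left|right].
pose J h := exists e u v, cX ^+ e * h = u * p + v * a.
have Jp : J p by exists 0%N, 1, 0; rewrite expr0 mul0r addr0.
have Ja : J a by exists 0%N, 0, 1; rewrite expr0 mul0r add0r.
have exd : exists d, `[< exists2 h, J h & lexord h 0 d >].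
  by exists d; apply/asboolP; exists p.
case: (ex_minnP exd) => e /asboolP[h Jh ho] emin.
(* A nonzero remainder, freed of its power of X, would be an element of [J] of order less than
   [e]. *)
have hJ q : J q -> divides h q.
  move=> [eq [uq [vq qE]]]; have [eh [uh [vh hE]]] := Jh.
  have [Q [r [qQ r0]]] := weierstrass_division q ho.
  have [rz|rn0] := eqVneq r 0; first by exists Q; rewrite qQ rz addr0 mulrC.
  have [s [d' ro]] := lexord_ex rn0; have [r' rE r'o] := lexord_split ro.
  suff /emin : `[< exists2 h, J h & lexord h 0 d' >].
    rewrite leqNgt; case: (ltnP d' e) => // /r0 r0s.
    by have [] := ro; rewrite r0s eqxx.
  apply/asboolP; exists r' => //.
  exists (eq + eh + s)%N, (cX ^+ eh * uq - cX ^+ eq * Q * uh),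
    (cX ^+ eh * vq - cX ^+ eq * Q * vh).
  rewrite exprD -mulrA -rE exprD.
  have -> : r = q - Q * h by rewrite qQ addrC addKr.
  rewrite mulrBr mulrAC [cX ^+ eq * _ * _]mulrAC qE.
  rewrite -[X in _ - X]mulrA [cX ^+ eh * (Q * h)]mulrCA hE; ring.
have [Q pE] := hJ _ Jp; have [w aE] := hJ _ Ja.
case: (pF _ _ pE) => [hU|QU]; last first.
  by case: npa; exists (Q^-1 * w); rewrite pE -mulrA mulVKr.
have [eh [uh [vh hE]]] := Jh.
(* Multiplying [X^eh h = uh p + vh a] by [b] turns both terms into multiples of [p]; then [X^eh] is
   cancelled. *)
have [z zE] : divides p (h * b).
  apply: (@lexord_dividesXn p _ (uh * b + vh * c) eh d) => //.
  by rewrite mulrA hE mulrDr mulrDl [p * (vh * c)]mulrCA -abE; ring.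
by exists (h^-1 * z); rewrite mulrCA -zE mulKr.
Qed.

Lemma irreducible_prime_prod p u (s : seq (cps2 R)) :
  irreducible_elt p -> u \is a GRing.unit -> divides p (u * \prod_(q <- s) q) ->
  exists2 q, q \in s & divides p q.
Proof.
move=> pI uU [c E].
have {u uU c E} : divides p (\prod_(q <- s) q).
  by exists (u^-1 * c); rewrite mulrCA -E mulKr.
elim: s => [|q s IH].
  rewrite big_nil => -[c E]; have [] := pI.
  by rewrite (_ : p \is a GRing.unit) //; apply/unitrPr; exists c.
rewrite big_cons => /(irreducible_prime pI)[pq|/IH[r rs pr]].
  by exists q; rewrite ?mem_head.
by exists r; rewrite ?inE ?rs ?orbT.
Qed.

Lemma factorization_ex f : f != 0 -> exists u (s : seq (cps2 R)),
  [/\ u \is a GRing.unit, (forall p, p \in s -> irreducible_elt p)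
    & f = u * \prod_(p <- s) p].
Proof.
move=> f0; have [k [d fo]] := lexord_ex f0.
(* The sum [k + d] is additive and vanishes exactly on units, so it drops strictly on both factors
   of a proper factorization. *)
move: {2}(k + d)%N (leqnn (k + d)) => N.
elim/ltn_ind: N f f0 k d fo => N IH f f0 k d fo kdN.
have [fU|fU] := boolP (f \is a GRing.unit).
  by exists f, [::]; rewrite big_nil mulr1; split.
have [fI|fI] := pselect (irreducible_elt f).
  exists 1, [:: f]; rewrite big_seq1 mul1r unitr1; split=> // p.
  by rewrite inE => /eqP ->.
have [a [b [fE aU bU]]] : exists a b,
    [/\ f = a * b, a \isn't a GRing.unit & b \isn't a GRing.unit].
  apply: contrapT => nab; apply: fI; split=> // a b fE.
  case: (boolP (a \is a GRing.unit)) => aU; [by left|].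
  case: (boolP (b \is a GRing.unit)) => bU; [by right|].
  by case: nab; exists a, b.
have a0 : a != 0 by apply: contraNneq f0 => a0; rewrite fE a0 mul0r.
have b0 : b != 0 by apply: contraNneq f0 => b0; rewrite fE b0 mulr0.
have [k1 [d1 ao]] := lexord_ex a0; have [k2 [d2 bo]] := lexord_ex b0.
have pos g l e : g \isn't a GRing.unit -> lexord g l e -> (0 < l + e)%N.
  move=> gU go; rewrite lt0n; apply: contraNneq gU => /eqP.
  by rewrite addn_eq0 => /andP[/eqP l0 /eqP e0]; subst l e; apply/cps2_unit_lexord.
have := pos _ _ _ aU ao; have := pos _ _ _ bU bo => p2 p1.
have := lexord_uniq fo; rewrite {1}fE => /(_ _ _ (lexordM ao bo)) [kE dE].
have [|u [s [uU sI aE]]] := IH (k1 + d1)%N _ a a0 _ _ ao (leqnn _); first by lia.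
have [|v [t [vU tI bE]]] := IH (k2 + d2)%N _ b b0 _ _ bo (leqnn _); first by lia.
exists (u * v), (s ++ t); split.
- by rewrite unitrMl.
- by move=> p; rewrite mem_cat => /orP[/sI|/tI].
- by rewrite big_cat fE aE bE mulrACA.
Qed.

Lemma factorization_size u v (s t : seq (cps2 R)) :
  u \is a GRing.unit -> v \is a GRing.unit ->
  (forall p, p \in s -> irreducible_elt p) -> (forall p, p \in t -> irreducible_elt p) ->
  u * \prod_(p <- s) p = v * \prod_(p <- t) p -> size s = size t.
Proof.
move=> uU; elim: s t v => [|p s IH] t v vU sI tI.
  rewrite big_nil mulr1; case: t tI => // q t tI uE.
  have [+ _] := tI q (mem_head _ _); case/negP.
  move: uU; rewrite uE unitrMr // big_cons.
  by move=> /unitrPr[z zE]; apply/unitrPr; exists (\prod_(j <- t) j * z); rewrite mulrA.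
rewrite big_cons => E; have pI := sI p (mem_head _ _).
have [|q qt [w qE]] := @irreducible_prime_prod p v t pI vU.
  by exists (u * \prod_(j <- s) j); rewrite -E mulrCA.
have wU : w \is a GRing.unit.
  by have [_ qF] := tI q qt; case: (qF _ _ qE) => //; case: pI => /negPf ->.
rewrite (perm_size (perm_to_rem qt)) /=; congr _.+1.
apply: (IH _ (v * w)).
- by rewrite unitrMl.
- by move=> r rs; apply: sI; rewrite inE rs orbT.
- by move=> r /mem_rem; apply: tI.
- apply: (@cps2_mulfI _ p); first exact: irreducible_neq0.
  rewrite mulrCA E (big_rem q) //= {1}qE; ring.
Qed.

(** By [factorization_size] all factorizations have the same length, so the choice made in [r0] is
    immaterial. *)
Lemma r0_eq u (s : seq (cps2 R)) :
  u \is a GRing.unit -> (forall p, p \in s -> irreducible_elt p) ->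
  r0 (u * \prod_(p <- s) p) = size s.
Proof.
move=> uU sI; rewrite /r0; set P := [set k | _].
have : exists k, P k by exists (size s), u, s.
move=> /(xgetPex 0%N) [v [t [vU tI E ->]]].
exact: esym (factorization_size uU vU sI tI E).
Qed.

Lemma r0_unit f : f \is a GRing.unit -> r0 f = 0%N.
Proof. by move=> fU; have := @r0_eq f [::] fU; rewrite big_nil mulr1 => ->. Qed.

Lemma r0_irreducible p : irreducible_elt p -> r0 p = 1%N.
Proof.
move=> pI; have := @r0_eq 1 [:: p] (unitr1 _); rewrite big_seq1 mul1r => -> // q.
by rewrite inE => /eqP ->.
Qed.

Lemma r0M f g : f != 0 -> g != 0 -> r0 (f * g) = (r0 f + r0 g)%N.
Proof.
move=> /factorization_ex[u [s [uU sI ->]]] /factorization_ex[v [t [vU tI ->]]].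
rewrite mulrACA -big_cat !r0_eq ?size_cat ?unitrMl // => p.
by rewrite mem_cat => /orP[/sI|/tI].
Qed.

Lemma r0_prod (I : eqType) (s : seq I) (F : I -> cps2 R) :
  (forall i, i \in s -> F i != 0) ->
  \prod_(i <- s) F i != 0 /\ r0 (\prod_(i <- s) F i) = \sum_(i <- s) r0 (F i).
Proof.
elim: s => [_|i s IH F0].
  by rewrite !big_nil r0_unit ?unitr1 // cps2_unit_neq0 ?unitr1.
have [|s0 sr] := IH; first by move=> j js; apply: F0; rewrite inE js orbT.
have i0 := F0 i (mem_head _ _).
by rewrite !big_cons r0M // sr; split=> //; exact: cps2_mulf_neq0.
Qed.
End UniqueFactorization.

(** * Pullback along a parametrized curve *)

Section BigSums.
Variable V : nmodType.

Lemma sum_ord_widen w N N' (F : nat -> V) : (w < N)%N -> (w < N')%N ->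
  (forall i, (w < i)%N -> F i = 0) -> \sum_(i < N) F i = \sum_(i < N') F i.
Proof.
move=> wN wN' F0; wlog NN : N N' wN wN' / (N <= N')%N => [H|].
  by case/orP: (leq_total N N') => NN; [exact: H|rewrite (H N' N)].
rewrite (big_ord_widen N' F NN) big_mkcond; apply: eq_bigr => i _; case: ifP => // iN.
by rewrite F0 //; lia.
Qed.

Lemma sum_ord_delta N (x : nat) (F : nat -> V) :
  \sum_(i < N) F i *+ (x == i :> nat) = if (x < N)%N then F x else 0.
Proof.
case: ifP => xN; last first.
  rewrite big1 // => i _; case: eqP => // xi; rewrite xi ltn_ord in xN; discriminate.
rewrite (bigD1 (Ordinal xN)) //= eqxx big1 ?addr0 // => i ix.
by case: eqP => // xi; case/eqP: ix; apply: val_inj.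
Qed.

Lemma sum_triangle N (F : nat -> nat -> V) :
  (forall k l, (N <= k + l)%N -> F k l = 0) ->
  \sum_(a < N) \sum_(k < a.+1) F k (a - k)%N = \sum_(k < N) \sum_(l < N) F k l.
Proof.
move=> F0; transitivity (\sum_(a < N) \sum_(k < N) \sum_(l < N) F k l *+ (k + l == a)%N).
  apply: eq_bigr => a _.
  rewrite (big_ord_widen N (fun k => F k (a - k)%N)) ?ltn_ord // big_mkcond.
  apply: eq_bigr => k _ /=.
  transitivity (\sum_(l < N) F k l *+ ((k <= a)%N && ((a - k)%N == l))); last first.
    apply: eq_bigr => l _; congr (_ *+ nat_of_bool _).
    by apply/andP/eqP => [[ka /eqP]|]; [|move=> kl; split; last apply/eqP]; lia.
  rewrite ltnS; case: leqP => ka /=; last by rewrite big1.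
  by rewrite sum_ord_delta; have := ltn_ord a; case: ifP => //; lia.
rewrite exchange_big; apply: eq_bigr => k _; rewrite exchange_big; apply: eq_bigr => l _.
rewrite (sum_ord_delta N (k + l) (fun=> F k l)); case: ltnP => // kl.
by rewrite F0.
Qed.
End BigSums.

Section Pullback.
Variable R : realType.
Variables (n m : nat) (al : R[i]).
Implicit Types f g : cps2 R.

(* The quasi-homogeneous part of weight [w] of [f], for the weights [n] of X  *)
(* and [m] of Y, evaluated at [X = 1].                                        *)
Definition wpart f w : {poly R[i]} :=
  \sum_(a < w.+1) \sum_(b < w.+1) (f a b *+ (n * a + m * b == w)%N) *: 'X^b.

(** [X^a Y^b] is pulled back to [X^(n a + m b) (al + Y)^b]. So row [i] of the pullback is the Taylor
    expansion at [al] of the part of weight [i]. *)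
Definition pb_coef f i j : R[i] := (wpart f i \Po ('X + al%:P))`_j.

Lemma normc_coef_binomial b j :
  Normc.normc ((('X + al%:P) ^+ b)`_j) <= (1 + Normc.normc al) ^+ b.
Proof.
elim: b j => [|b IH] j.
  by rewrite expr0 coef1; case: eqP; rewrite ?Normc.normc1 ?Normc.normc0.
rewrite exprS mulrDl coefD coefXM coefCM exprS mulrDl mul1r.
apply: le_trans (normcD_le _ _) _; rewrite Normc.normcM lerD //.
  case: eqP => _; last exact: IH.
  by rewrite Normc.normc0 exprn_ge0 ?addr_ge0 ?normc_ge0.
by rewrite ler_wpM2l ?normc_ge0.
Qed.

Lemma pb_coefE f i j : pb_coef f i j =
  \sum_(a < i.+1) \sum_(b < i.+1) (f a b *+ (n * a + m * b == i)%N) * (('X + al%:P) ^+ b)`_j.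
Proof.
rewrite /pb_coef /wpart raddf_sum /= coef_sum; apply: eq_bigr => a _.
rewrite raddf_sum /= coef_sum; apply: eq_bigr => b _.
by rewrite comp_polyZ comp_Xn_poly coefZ.
Qed.

Lemma pb_sig f : {g : cps2 R | forall i j, g i j = pb_coef f i j}.
Proof.
suff gP : Fps2 (pb_coef f) \in @cps2_pred R by exists (Cps2 gP).
have [M [A [M0 A1 fb]]] := cps2_bounded f.
have A0 : 0 <= A by apply: le_trans A1.
pose L := 1 + Normc.normc al.
have L1 : 1 <= L by rewrite lerDl normc_ge0.
have L0 : 0 <= L by apply: le_trans L1.
(* Row [i] sums [(i + 1)^2 <= 4^i] terms with [a, b <= i], each at most [M (A^2 L)^i]. *)
pose B := 4 * A ^+ 2 * L.
have A21 : 1 <= A ^+ 2 by rewrite exprn_ege1.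
have B1 : 1 <= B.
  have := ler_pM ler01 ler01 A21 L1; rewrite /B; lra.
apply: (@bounded2_mem _ _ M B) => [|i j]; first by apply: lt_le_trans B1.
apply: (@le_trans _ _ (M * B ^+ i)); last first.
  by rewrite ler_wpM2l // ler_weXn2l // leq_addr.
rewrite pb_coefE; apply: le_trans (normc_sum _ _) _.
apply: (@le_trans _ _ (\sum_(a < i.+1) \sum_(b < i.+1) M * (A ^+ 2 * L) ^+ i)).
  apply: ler_sum => a _; apply: le_trans (normc_sum _ _) _; apply: ler_sum => b _.
  rewrite Normc.normcM exprMn mulrA ler_pM ?normc_ge0 //.
    apply: le_trans (_ : Normc.normc (f a b) <= _).
      by case: (_ == _); rewrite ?mulr1n // mulr0n Normc.normc0 normc_ge0.
    apply: le_trans (fb _ _) _; rewrite ler_wpM2l // -exprM ler_weXn2l //.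
    by have := ltn_ord a; have := ltn_ord b; lia.
  apply: le_trans (normc_coef_binomial _ _) _; rewrite ler_weXn2l //.
  by have := ltn_ord b; lia.
rewrite !sumr_const !card_ord -mulrnA -mulr_natl mulrCA ler_wpM2l //.
rewrite (_ : B = 4 * (A ^+ 2 * L)); last by rewrite /B mulrA.
rewrite [leRHS]exprMn ler_wpM2r ?exprn_ge0 ?mulr_ge0 ?exprn_ge0 //.
rewrite -natrX ler_nat (_ : 4 = 2 * 2)%N // expnMn.
by rewrite leq_mul // ltn_expl.
Qed.

(* The pullback f(X^n, (al + Y) X^m). *)
Definition pb f : cps2 R := sval (pb_sig f).

Lemma coef2pb f i j : pb f i j = (wpart f i \Po ('X + al%:P))`_j.
Proof. exact: (svalP (pb_sig f)). Qed.

Lemma coef_CY b i j : ((cC al + cY) ^+ b) i j = if i == 0%N then (('X + al%:P) ^+ b)`_j else 0.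
Proof.
elim: b i j => [|b IH] i j.
  by rewrite !expr0 coef21 coef1; case: eqP.
have -> : ((cC al + cY) ^+ b.+1) i j =
    (cC al * (cC al + cY) ^+ b) i j + (cY * (cC al + cY) ^+ b) i j.
  by rewrite exprS mulrDl.
move: ((cC al + cY) ^+ b) IH => p IH.
rewrite [X in X + _]coef2CM [X in _ + X]coef2YM IH exprS mulrDl coefD coefCM coefXM addrC.
by case: j => [|j]; rewrite ?IH; case: eqP; rewrite ?mulr0 ?addr0.
Qed.

Hypotheses (n0 : (0 < n)%N) (m0 : (0 < m)%N).

Lemma wpart_coef f w N b : (w < N)%N ->
  (wpart f w)`_b = \sum_(a < N) f a b *+ (n * a + m * b == w)%N.
Proof.
move=> wN; rewrite /wpart coef_sum.
rewrite (@sum_ord_widen _ w N w.+1 (fun a => f a b *+ (n * a + m * b == w)%N)) //; last first.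
  by move=> a wa; case: eqP => //; nia.
apply: eq_bigr => a _; rewrite coef_sum.
under eq_bigr do rewrite coefZ coefXn.
rewrite (eq_bigr (fun i : 'I_w.+1 =>
  (f a i *+ (n * a + m * i == w)%N) *+ (b == i))); last first.
  by move=> i _; case: (b == i); rewrite ?mulr1 ?mulr0.
rewrite (sum_ord_delta _ b (fun i => f a i *+ (n * a + m * i == w)%N)).
by case: ltnP => // wb; case: eqP => //; nia.
Qed.

Lemma wpartE f w N : (w < N)%N -> wpart f w =
  \sum_(a < N) \sum_(b < N) (f a b *+ (n * a + m * b == w)%N) *: 'X^b.
Proof.
move=> wN; rewrite /wpart.
rewrite (@sum_ord_widen _ w N w.+1
  (fun a => \sum_(b < N) (f a b *+ (n * a + m * b == w)%N) *: 'X^b)) //; last first.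
  by move=> a wa; rewrite big1 // => b _; case: eqP => [|_]; [nia|rewrite scale0r].
apply: eq_bigr => a _.
apply: (@sum_ord_widen _ w w.+1 N
  (fun b => (f a b *+ (n * a + m * b == w)%N) *: 'X^b)) => // b wb.
by case: eqP => [|_]; [nia|rewrite scale0r].
Qed.

Lemma wpartD f g w : wpart (f + g) w = wpart f w + wpart g w.
Proof.
apply/polyP => b; rewrite coefD !(@wpart_coef _ _ w.+1) // -big_split.
by apply: eq_bigr => a _; rewrite coef2D mulrnDl.
Qed.

Lemma wpart1 w : wpart 1 w = if w == 0%N then 1 else 0.
Proof.
apply/polyP => b; rewrite (@wpart_coef _ _ w.+1) // big_ord_recl big1 ?addr0 => [|a _].
  rewrite coef21 muln0 add0n /=; case: b => [|b] /=.
    by rewrite muln0 eq_sym; case: eqP => _; rewrite ?coef1 ?coef0.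
  by rewrite mul0rn; case: eqP => _; rewrite ?coef1 ?coef0.
by rewrite coef21 mul0rn.
Qed.

(** Weights add under multiplication. Multiplicativity of the pullback is this identity translated
    by [al]. *)
Lemma wpartM f g w : wpart (f * g) w = \sum_(v < w.+1) wpart f v * wpart g (w - v)%N.
Proof.
apply/polyP => b; rewrite (@wpart_coef _ _ w.+1) // coef_sum.
pose T k l k' := f k l * g k' (b - l)%N.
transitivity (\sum_(l < b.+1) \sum_(k < w.+1) \sum_(k' < w.+1)
    T k l k' *+ (n * (k + k') + m * b == w)%N).
  transitivity (\sum_(l < b.+1) \sum_(a < w.+1) \sum_(k < a.+1)
      T k l (a - k)%N *+ (n * (k + (a - k)) + m * b == w)%N).
    rewrite exchange_big; apply: eq_bigr => a _; rewrite coef2M exchange_big /= -sumrMnl.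
    apply: eq_bigr => l _; rewrite -sumrMnl; apply: eq_bigr => k _.
    by rewrite subnKC // -ltnS.
  apply: eq_bigr => l _.
  apply: (sum_triangle (F := fun k k' => T k l k' *+ (n * (k + k') + m * b == w)%N)) => k k' wk.
  by case: eqP => //; nia.
transitivity (\sum_(v < w.+1) \sum_(l < b.+1) \sum_(k < w.+1) \sum_(k' < w.+1)
    (f k l *+ (n * k + m * l == v)%N) *
    (g k' (b - l)%N *+ (n * k' + m * (b - l) == w - v)%N)); last first.
  apply: eq_bigr => v _; rewrite coefM; apply: eq_bigr => l _.
  rewrite !(@wpart_coef _ _ w.+1) ?ltnS ?leq_subr -1?ltnS //.
  rewrite mulr_suml; apply: eq_bigr => k _; rewrite mulr_sumr; apply: eq_bigr => k' _.
  by [].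
rewrite [RHS]exchange_big; apply: eq_bigr => l _.
rewrite [RHS]exchange_big; apply: eq_bigr => k _.
rewrite [RHS]exchange_big; apply: eq_bigr => k' _ /=.
transitivity (\sum_(v < w.+1)
  (T k l k' *+ (n * k' + m * (b - l) == w - v)%N) *+ (n * k + m * l == v)%N); last first.
  by apply: eq_bigr => v _; rewrite mulrnAl mulrnAr mulrnAC.
rewrite (sum_ord_delta w.+1 _ (fun v => T k l k' *+ (n * k' + m * (b - l) == w - v)%N)).
have lb := ltn_ord l; case: ltnP => wl.
  by congr (_ *+ nat_of_bool _); apply/eqP/eqP; nia.
by case: eqP => //; nia.
Qed.

Lemma pbM f g : pb (f * g) = pb f * pb g.
Proof.
apply: cps2P => i j; rewrite coef2M coef2pb wpartM raddf_sum coef_sum.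
apply: eq_bigr => k _; rewrite /= comp_polyM coefM.
by apply: eq_bigr => l _; rewrite !coef2pb.
Qed.

Lemma pbD f g : pb (f + g) = pb f + pb g.
Proof.
by apply: cps2P => i j; rewrite coef2D !coef2pb wpartD comp_polyD coefD.
Qed.

Lemma pb1 : pb 1 = 1.
Proof.
apply: cps2P => i j; rewrite coef2pb wpart1 coef21.
case: eqP => _; last by rewrite comp_poly0 coef0.
by rewrite -polyC1 comp_polyC coefC; case: eqP.
Qed.

(** The morphism laws rest on [n0] and [m0], so the structure is delivered as a witness. It serves
    to move the pullback through powers and determinants. *)
Lemma pb_rmorphism : exists phi : {rmorphism cps2 R -> cps2 R}, phi =1 pb.
Proof.
have pb0 : pb 0 = 0 by apply: (addrI (pb 0)); rewrite -pbD !addr0.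
have pbB : zmod_morphism pb.
  by move=> f g; apply/eqP; rewrite eq_sym subr_eq -pbD subrK.
pose phi1 := GRing.isZmodMorphism.Build _ _ pb pbB.
pose phi2 := GRing.isMonoidMorphism.Build _ _ pb (conj pb1 pbM).
by exists (HB.pack_for {rmorphism cps2 R -> cps2 R} pb phi1 phi2).
Qed.

Lemma subst_pb f :
  fps2_subst f (fps2X _ ^+ n) ((fps2_const al + fps2Y _) * fps2X _ ^+ m) = pb f :> fps2 R[i].
Proof.
apply: fps2P => i j; rewrite [RHS]coef2pb (@wpartE _ _ (i + j).+1) ?ltnS ?leq_addr //.
rewrite raddf_sum /= coef_sum; apply: eq_bigr => a _.
rewrite raddf_sum /= coef_sum; apply: eq_bigr => b _.
rewrite comp_polyZ comp_Xn_poly coefZ mulrnAl -mulrnAr; congr (_ * _).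
have E : (fps2X R[i] ^+ n) ^+ a * ((fps2_const al + fps2Y R[i]) * fps2X R[i] ^+ m) ^+ b =
    val (cX ^+ (n * a + m * b) * (cC al + cY) ^+ b).
  rewrite rmorphM !rmorphXn rmorphD /= val_cX val_cC val_cY exprMn -!exprM exprD -!mulrA.
  by congr (_ * _); exact: mulrC.
transitivity ((cX ^+ (n * a + m * b) * (cC al + cY) ^+ b) i j).
  exact: (congr1 (fun h : fps2 R[i] => h i j) E).
rewrite [LHS]coef2XnM coef_CY; case: ltngtP => // ni.
  by rewrite subn_eq0 leqNgt ni.
by rewrite ni subnn.
Qed.
End Pullback.

(** * Tangential multiplicity *)

Section ResiduePolynomials.
Variable K : fieldType.
Implicit Types F P : {poly K}.

Lemma poly_residue F n c : (0 < n)%N -> (c < n)%N ->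
  (forall b, F`_b != 0 -> (b %% n)%N = c) -> exists P, F = 'X^c * (P \Po 'X^n).
Proof.
move=> n0 cn Fc; pose P := \poly_(s < size F) F`_(c + n * s)%N; exists P.
apply/polyP => b; rewrite coefXnM coef_comp_poly_Xn //.
have [Fb|Fb] := eqVneq F`_b 0.
  rewrite Fb; case: ltnP => // cb; case: ifP => // /divnK nb.
  by rewrite coef_poly mulnC nb subnKC // Fb; case: ifP.
have bc := Fc b Fb; have bE : b = (c + n * (b %/ n))%N.
  by rewrite {1}(divn_eq b n) bc; lia.
move: (b %/ n)%N bE => q bE; subst b.
rewrite ltnNge leq_addr /= addKn dvdn_mulr // mulKn // coef_poly; case: ltnP => // sq.
by move/leq_sizeP: sq => -> //; nia.
Qed.

(** Write [X^n - al^n = (X - al) S]. In characteristic 0, [S(al) = n al^(n-1)] is nonzero, so [al]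
    has in [P(X^n)] the multiplicity that [al^n] has in [P]; the factor [X^c] does not vanish at
    [al]. *)
Lemma root_mult_Xn c P n al d W : [pchar K] =i pred0 -> (0 < n)%N -> al != 0 -> P != 0 ->
  'X^c * (P \Po 'X^n) = W * ('X - al%:P) ^+ d ->
  exists P1, P = P1 * ('X - (al ^+ n)%:P) ^+ d.
Proof.
move=> ch n0 al0 P0; have [e [P1 + PE]] := multiplicity_XsubC P (al ^+ n).
rewrite P0 /= => P1r E.
pose S := \sum_(i < n) ('X : {poly K}) ^+ (n.-1 - i) * al%:P ^+ i.
have SE : 'X^n - (al ^+ n)%:P = ('X - al%:P) * S.
  by rewrite polyC_exp subrXX; case: n n0 @S {P1r PE E} => // n _ S.
have Sr : S.[al] != 0.
  rewrite /S horner_sum (eq_bigr (fun=> al ^+ n.-1)) => [|i _].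
    rewrite sumr_const card_ord -mulr_natr mulf_neq0 ?expf_neq0 //.
    by rewrite ((pcharf0P K).1 ch) -lt0n.
  rewrite hornerM !horner_exp hornerX hornerC -exprD subnK //.
  by have := ltn_ord i; lia.
pose T := 'X^c * (P1 \Po 'X^n) * S ^+ e.
have Tr : T.[al] != 0.
  rewrite /T !hornerM !horner_exp hornerX horner_comp hornerXn !mulf_neq0 ?expf_neq0 //.
have TE : T * ('X - al%:P) ^+ e = W * ('X - al%:P) ^+ d.
  rewrite -E PE comp_polyM rmorphXn /= comp_polyB comp_polyX comp_polyC SE exprMn /T; ring.
have [de|ed] := leqP d e.
  by exists (P1 * ('X - (al ^+ n)%:P) ^+ (e - d)); rewrite -mulrA -exprD subnK.
case/eqP: Tr; move: TE; rewrite -(subnK (ltnW ed)) exprD mulrA => /mulIf ->.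
  rewrite hornerM horner_exp hornerXsubC subrr expr0n subn_eq0 leqNgt ed mulr0 //.
by rewrite expf_neq0 // polyXsubC_eq0.
Qed.
End ResiduePolynomials.

Section TangentialMultiplicity.
Variable R : realType.
Variables (n m : nat).
Hypotheses (n0 : (0 < n)%N) (m0 : (0 < m)%N).
Implicit Types f g h p : cps2 R.

Lemma wpart_coef_at f a b : (wpart n m f (n * a + m * b))`_b = f a b.
Proof.
rewrite (@wpart_coef _ _ _ n0 m0 _ _ (n * a + m * b).+1) // (bigD1 (inord a)) //=.
rewrite inordK ?eqxx; last by nia.
rewrite big1 ?addr0 // => i ia; case: eqP => // E; case/eqP: ia; apply: val_inj.
by rewrite /= inordK; nia.
Qed.

Lemma wpart_coef_neq0 f w b : (wpart n m f w)`_b != 0 ->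
  exists2 a, f a b != 0 & (n * a + m * b = w)%N.
Proof.
rewrite (@wpart_coef _ _ _ n0 m0 _ _ w.+1) // => Fb; apply: contrapT => nex.
case/eqP: Fb; apply: big1 => a _; case: eqP => // E; apply/eqP/negPn/negP => fa.
by apply: nex; exists a.
Qed.

Hypothesis nm : coprime n m.

(** Equal weights give [n (a - a') = m (b' - b)], and [n] is prime to [m]. *)
Lemma wpart_residue f w b b' : (wpart n m f w)`_b != 0 -> (wpart n m f w)`_b' != 0 ->
  b = b' %[mod n].
Proof.
move=> /wpart_coef_neq0[a _ aE] /wpart_coef_neq0[a' _ a'E].
wlog bb : a b a' b' aE a'E / (b <= b')%N => [H|].
  by case/orP: (leq_total b b') => bb; [|symmetry]; apply: H bb; eassumption.
apply/esym/eqP; rewrite eqn_mod_dvd // -(Gauss_dvdr _ nm) mulnBr.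
rewrite (_ : _ - _ = n * (a - a'))%N ?dvdn_mulr //; nia.
Qed.

Lemma wpart_residueE f w : wpart n m f w != 0 ->
  exists c P, P != 0 /\ wpart n m f w = 'X^c * (P \Po 'X^n).
Proof.
set F := wpart _ _ _ _ => F0; have lF : F`_(size F).-1 != 0 by rewrite -lead_coefE lead_coef_eq0.
have [||P FE] := @poly_residue _ F n ((size F).-1 %% n)%N n0.
- by rewrite ltn_mod.
- by move=> b Fb; apply: wpart_residue Fb lF.
exists ((size F).-1 %% n)%N, P; split=> //.
by apply: contraNneq F0 => P0; rewrite FE P0 comp_poly0 mulr0.
Qed.

(** A part has the form [Y^c P(Y^n)], so a nonzero root matters only through its n-th power. This
    lets the principal root stand for any n-th root. *)
Lemma wpart_root_conj f w al1 al2 : al1 ^+ n = al2 ^+ n -> al1 != 0 ->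
  root (wpart n m f w) al1 -> root (wpart n m f w) al2.
Proof.
have [->|/wpart_residueE[c [P [_ ->]]]] := eqVneq (wpart n m f w) 0; first by rewrite !root0.
move=> E a0; rewrite !rootE !hornerM !horner_comp !hornerXn -E !mulf_eq0.
by rewrite [al1 ^+ c == 0]expf_eq0 (negPf a0) andbF /= => ->; rewrite orbT.
Qed.

Variable al : R[i].
Hypothesis al0 : al != 0.

Lemma wpart_shiftK F : (F \Po ('X + al%:P)) \Po ('X - al%:P) = F.
Proof. by rewrite -comp_polyA comp_polyD comp_polyX comp_polyC subrK comp_polyXr. Qed.

Lemma wpart_eq0 f w : (forall j, pb n m al f w j = 0) -> wpart n m f w = 0.
Proof.
move=> f0; rewrite -[LHS]wpart_shiftK.
have -> : wpart n m f w \Po ('X + al%:P) = 0; last by rewrite comp_poly0.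
by apply/polyP => j; rewrite coef0 -coef2pb.
Qed.

(** Translation by [al] is invertible, so a row of the pullback vanishes only if the part of that
    weight does: [k] is the lowest weight of [f]. *)
Lemma pb_weight_min f k d a b : lexord (pb n m al f) k d -> f a b != 0 ->
  (k <= n * a + m * b)%N.
Proof.
move=> [_ f2 _] fab; rewrite leqNgt; apply/negP => wk.
by move: fab; rewrite -wpart_coef_at wpart_eq0 ?coef0 ?eqxx // => j; apply: f2.
Qed.

Lemma pb_wpart_neq0 f k d : lexord (pb n m al f) k d -> wpart n m f k != 0.
Proof.
by case=> + _ _; apply: contraNneq; rewrite coef2pb => ->; rewrite comp_poly0 coef0.
Qed.

Lemma pb_wpart_factor f k d : lexord (pb n m al f) k d -> exists c P, P != 0 /\
  wpart n m f k = 'X^c * ((P * ('X - (al ^+ n)%:P) ^+ d) \Po 'X^n).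
Proof.
move=> fo; have [c [P [P0 FE]]] := wpart_residueE (pb_wpart_neq0 fo).
have [_ _ f3] := fo; set F := wpart n m f k in FE *.
(* The first [d] Taylor coefficients at [al] vanish; [W] is the rest of the expansion, translated
   back. *)
pose W := drop_poly d (F \Po ('X + al%:P)) \Po ('X - al%:P).
have FW : F = W * ('X - al%:P) ^+ d.
  rewrite -[LHS]wpart_shiftK -(poly_take_drop d (F \Po _)).
  rewrite (_ : take_poly d _ = 0) ?add0r; last first.
    apply/polyP => j; rewrite coef_take_poly coef0; case: ifP => // jd.
    by rewrite -coef2pb f3.
  by rewrite comp_polyM comp_Xn_poly.
have [P1 PE] := root_mult_Xn (pchar_num _) n0 al0 P0 (etrans (esym FE) FW).
exists c, P1; split; last by rewrite FE PE.
by apply: contraNneq P0 => P10; rewrite PE P10 mul0r.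
Qed.

Lemma pb_wpart_size f k d c P : P != 0 ->
  wpart n m f k = 'X^c * ((P * ('X - (al ^+ n)%:P) ^+ d) \Po 'X^n) ->
  size (wpart n m f k) = (c + n * (d + (size P).-1)).+1.
Proof.
move=> P0 ->; set Q := P * _.
have Q0 : Q != 0 by rewrite mulf_neq0 // expf_neq0 // polyXsubC_eq0.
have sQ : size Q = (d + (size P).-1).+1.
  rewrite size_mul ?expf_neq0 ?polyXsubC_eq0 // size_exp_XsubC.
  by rewrite [in LHS](polySpred P0) !addSn /= addnS addnC.
have C0 : Q \Po 'X^n != 0.
  apply: contraNneq Q0 => C0; apply/eqP/polyP => i.
  have := congr1 (fun p : {poly R[i]} => p`_(i * n)) C0.
  by rewrite /= coef_comp_poly_Xn // dvdn_mull // mulnK // !coef0.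
rewrite mulrC size_mulXn //; have := size_comp_poly Q 'X^n; rewrite size_polyXn sQ /=.
by move=> E; rewrite (polySpred C0) E mulnC addnS.
Qed.

Lemma wpart_degree_le f k d B b : lexord (pb n m al f) k d -> f 0%N B != 0 ->
  (wpart n m f k)`_b != 0 -> (b <= B)%N.
Proof.
move=> fo fB /wpart_coef_neq0[a _ aE].
by have := pb_weight_min fo fB; rewrite -aE muln0 add0n; nia.
Qed.

Lemma wpart_size_le f k d B : lexord (pb n m al f) k d -> f 0%N B != 0 ->
  (size (wpart n m f k) <= B.+1)%N.
Proof.
move=> fo fB; apply/leq_sizeP => j Bj; apply/eqP/negPn/negP.
by move/(wpart_degree_le fo fB); rewrite leqNgt Bj.
Qed.

Lemma tangential_mult_le f k d B : lexord (pb n m al f) k d -> f 0%N B != 0 ->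
  (n * d <= B)%N.
Proof.
move=> fo fB; have [c [P [P0 FE]]] := pb_wpart_factor fo.
by have := wpart_size_le fo fB; rewrite (pb_wpart_size P0 FE); nia.
Qed.

(** Equality in [tangential_mult_le] leaves no room in the degree: [c = 0] and [P] is constant, so
    the lowest part is a constant times [(Y^n - al^n)^d]. Its two ends give the slope, its roots the
    coefficient. *)
Lemma tangential_mult_eq f k d : lexord (pb n m al f) k d -> f 0%N (n * d)%N != 0 ->
  [/\ k = (m * (n * d))%N, exists2 A, f A 0%N != 0 & (n * A = k)%N
    & forall be, root (wpart n m f k) be -> be ^+ n = al ^+ n].
Proof.
move=> fo fB; have [c [P [P0 FE]]] := pb_wpart_factor fo.
have sF := pb_wpart_size P0 FE; have := wpart_size_le fo fB; rewrite sF => sFB.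
have c0 : c = 0%N by nia.
have /eqP/size_poly1P[z z0 PE] : size P = 1%N.
  by have := size_poly_gt0 P; rewrite P0; nia.
subst c P; rewrite expr0 mul1r comp_polyM comp_polyC rmorphXn /= in FE.
rewrite comp_polyB comp_polyX comp_polyC in FE.
split.
- have : (wpart n m f k)`_(n * d) != 0.
    have -> : (n * d = (size (wpart n m f k)).-1)%N by rewrite sF size_polyC z0; lia.
    by rewrite -lead_coefE lead_coef_eq0 -size_poly_eq0 sF.
  by move=> /wpart_coef_neq0[a _ aE]; have := pb_weight_min fo fB; nia.
- have : (wpart n m f k)`_0 != 0.
    rewrite -horner_coef0 FE hornerM horner_exp !hornerE expr0n -[n == 0%N]negbK -lt0n n0 /=.
    by rewrite sub0r mulf_neq0 // expf_neq0 // oppr_eq0 expf_neq0.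
  by move=> /wpart_coef_neq0[A fA]; rewrite muln0 addn0 => <-; exists A.
- move=> be; rewrite rootE FE hornerM horner_exp !hornerE mulf_eq0 (negPf z0) /=.
  by rewrite expf_eq0 => /andP[_]; rewrite subr_eq0 => /eqP.
Qed.
End TangentialMultiplicity.

(** * Descent along the pullback *)

Section SeriesInX.
Variable R : realType.

Definition seriesX : {pred cps2 R} :=
  [pred f : cps2 R | `[< forall i j, (0 < j)%N -> f i j = 0 >]].

Lemma seriesXP (f : cps2 R) : reflect (forall i j, (0 < j)%N -> f i j = 0) (f \in seriesX).
Proof. exact: asboolP. Qed.

Fact seriesX_subring : subring_closed seriesX.
Proof.
split=> [|f g|f g].
- by apply/seriesXP => i [|j] // _; rewrite coef21 andbF.
- by move=> /seriesXP f0 /seriesXP g0; apply/seriesXP => i j j0; rewrite coef2B f0 // g0 // subrr.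
- move=> /seriesXP f0 /seriesXP g0; apply/seriesXP => i j j0; rewrite coef2M.
  rewrite big1 // => k _; rewrite big1 // => l _; have [l0|/f0 ->] := posnP l; last by rewrite mul0r.
  by rewrite [g _ _]g0 ?mulr0 // l0 subn0.
Qed.

HB.instance Definition _ := GRing.isSubringClosed.Build (cps2 R) seriesX seriesX_subring.

Lemma char_poly_seriesX N (C : 'M[cps2 R]_N) : (forall i j, C i j \in seriesX) ->
  char_poly C \is a polyOver seriesX.
Proof.
move=> CX; rewrite /char_poly /determinant rpred_sum // => s _.
rewrite rpredM ?rpred_sign // rpred_prod // => i _.
by rewrite !mxE rpredB ?polyOverC // rpredMn // polyOverX.
Qed.

(** The lower coefficients are series in X alone, so their terms never reach [X^0 Y^N]; the leading
    term contributes 1. *)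
Lemma char_poly_horner_coef N (C : 'M[cps2 R]_N) : (forall i j, C i j \in seriesX) ->
  (char_poly C).[cY] 0%N N = 1.
Proof.
move=> CX; have /polyOverP coefX := char_poly_seriesX CX.
have -> : (char_poly C).[cY] =
    \sum_(i < N) (char_poly C)`_i * cY ^+ i + (char_poly C)`_N * cY ^+ N.
  by rewrite horner_coef size_char_poly big_ord_recr.
rewrite coef2D coef2_sum.
rewrite [X in X + _]big1 ?add0r => [|i _].
  have cN : (char_poly C)`_N = 1.
    by have /monicP := char_poly_monic C; rewrite lead_coefE size_char_poly.
  by rewrite cN mulrC coef2YnM leqnn subnn coef21.
rewrite mulrC coef2YnM ltnW //; have /seriesXP -> // := coefX i.
by rewrite subn_gt0.
Qed.
End SeriesInX.

Section Descent.
Variable R : realType.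
Variables (n m : nat) (al : R[i]).
Hypotheses (n0 : (0 < n)%N) (m0 : (0 < m)%N) (nm : coprime n m) (al0 : al != 0).
Implicit Types f g h p : cps2 R.
Local Notation pb := (pb n m al).
Local Notation wpart := (wpart n m).

Lemma pb_neq0 f : f != 0 -> pb f != 0.
Proof.
move=> /cps2_neq0P[a [b fab]]; apply: contraNneq fab => f0.
by rewrite -(wpart_coef_at n0 m0) (@wpart_eq0 _ _ _ al) ?coef0 // => j; rewrite f0.
Qed.

Lemma wpart_seriesX f w : f \in @seriesX R ->
  wpart f w = (if (n %| w)%N then f (w %/ n)%N 0%N else 0)%:P.
Proof.
move=> /seriesXP f0; apply/polyP => b; rewrite coefC.
have [Fb|Fb] := eqVneq (wpart f w)`_b 0; last first.
  have [a fab <-] := wpart_coef_neq0 n0 m0 Fb.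
  case: b fab {Fb} => [|b] fab; last by rewrite f0 ?eqxx in fab.
  by rewrite muln0 addn0 dvdn_mulr // mulKn // -(wpart_coef_at n0 m0) muln0 addn0.
rewrite Fb; case: b Fb => // Fb; case: ifP => //= /divnK nw.
by rewrite -(wpart_coef_at n0 m0) muln0 addn0 mulnC nw Fb.
Qed.

Lemma coef2pb_seriesX f i j : f \in @seriesX R ->
  pb f i j = if (j == 0%N) && (n %| i)%N then f (i %/ n)%N 0%N else 0.
Proof.
move=> fX; rewrite coef2pb wpart_seriesX // comp_polyC coefC.
by case: (j == 0%N); case: (n %| i)%N.
Qed.

Lemma pbX : pb cX = cX ^+ n.
Proof.
have XX : cX \in @seriesX R.
  by apply/seriesXP => i j j0; rewrite val_cX /= [j == _]gtn_eqF // andbF.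
apply: cps2P => i j; rewrite coef2pb_seriesX // -[cX ^+ n]mulr1 coef2XnM coef21 val_cX /=.
have [/dvdnP[q ->]|ni] := boolP (n %| i)%N.
  rewrite mulnK // andbT andbC; case: (j == 0%N); last first.
    by rewrite andbF; case: ifP.
  rewrite andbT; case: (ltngtP q 1) => q1.
  - by rewrite leqNgt (_ : (q * n < n)%N) //; nia.
  - by rewrite (_ : (n <= q * n)%N) 1?(_ : (q * n - n == 0)%N = false) //; nia.
  - by rewrite q1 mul1n leqnn subnn.
rewrite andbF; case: ltngtP => // ni'.
  by rewrite subn_eq0 leqNgt ni'.
by rewrite -ni' dvdnn in ni.
Qed.

Lemma lexord_pbXn s f k d : lexord (pb (cX ^+ s * f)) k d -> exists k', lexord (pb f) k' d.
Proof.
rewrite pbM // (_ : pb (cX ^+ s) = cX ^+ (n * s)) => [fo|]; last first.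
  have [phi phiE] := pb_rmorphism al n0 m0.
  by rewrite -phiE rmorphXn phiE pbX exprM.
have [_ _] := lexord_Mr (lexordX R (n * s)) fo; rewrite subn0.
by exists (k - n * s)%N.
Qed.

(* Divide [p] by [H]: the remainder has [Y]-degree less than [n * d], whereas *)
(* its pullback is a multiple of [h], which forces at least that degree.      *)
Lemma divides_of_pb H p h k l w d : lexord H 0 (n * d) -> pb H = cX ^+ l * h ->
  lexord h 0 d -> pb p = cX ^+ k * (h * w) -> divides H p.
Proof.
move=> Ho Hh ho ph; have [q [r [pE r0]]] := weierstrass_division p Ho.
have [rz|rn0] := eqVneq r 0; first by exists q; rewrite pE rz addr0 mulrC.
have [s [B ro]] := lexord_ex rn0; have [r' rE r'o] := lexord_split ro.
have BN : (B < n * d)%N.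
  by rewrite ltnNge; apply/negP => /r0 => rB; have [] := ro; rewrite rB eqxx.
have pbr : pb r = h * (cX ^+ k * w - pb q * cX ^+ l).
  have -> : pb r = pb p - pb q * pb H by rewrite -pbM // pE pbD // addrC addKr.
  by rewrite ph Hh; ring.
have [k1 [d1 pbro]] := lexord_ex (pb_neq0 rn0).
have [_ dd1 _] : [/\ (0 <= k1)%N, (d <= d1)%N &
    lexord (cX ^+ k * w - pb q * cX ^+ l) (k1 - 0) (d1 - d)].
  by apply: lexord_Mr ho _; rewrite -pbr.
(* [tangential_mult_le] wants a pure power of Y, so the factor [X^s] is removed first; this changes
   [k1] but not [d1]. *)
rewrite rE in pbro; have [k2 r'po] := lexord_pbXn pbro.
have [r'B _ _] := r'o; have := tangential_mult_le n0 m0 nm al0 r'po r'B; nia.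
Qed.

(** The monomials [X^s Y^t] with [s < n] and [t < d], numbered [s * d + t], so that the first one is
    1. *)
Let basis d (i : 'I_(n * d)) : cps2 R := cX ^+ (i %/ d) * cY ^+ (i %% d).

(** Weierstrass division by [h] bounds the Y-degree, and sorting the exponents of X modulo [n] does
    the rest. For [c] in C{X}, [pb c] is [c(X^n)], so these are coordinates over C{X^n}. *)
Lemma quotient_coordinates h d b : lexord h 0 d -> exists w (c : 'I_(n * d) -> cps2 R),
  (forall i, c i \in @seriesX R) /\ b = h * w + \sum_i pb (c i) * basis i.
Proof.
move=> ho; have [q [r [bE r0]]] := weierstrass_division b ho.
have [M [A [M0 A1 rb]]] := cps2_bounded r.
have A0 : 0 <= A by apply: le_trans A1.
have cex (i : 'I_(n * d)) : exists c : cps2 R, forall u v,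
    c u v = if v == 0%N then r (n * u + i %/ d)%N (i %% d)%N else 0.
  apply: (@cps2_of_bounded _ _ (M * A ^+ (i %/ d + i %% d)) (A ^+ n)).
    by rewrite exprn_gt0 // (lt_le_trans _ A1).
  move=> u v; case: eqP => [->|_]; last first.
    by rewrite Normc.normc0 !mulr_ge0 ?exprn_ge0.
  apply: le_trans (rb _ _) _; rewrite -mulrA ler_wpM2l // -exprM -exprD.
  by rewrite ler_weXn2l //; lia.
have [c cE] := fin_all_exists cex; exists q, c.
have cX' i : c i \in @seriesX R by apply/seriesXP => u v v0; rewrite cE gtn_eqF.
split=> //; rewrite bE mulrC; congr (_ + _); apply: cps2P => u v.
rewrite coef2_sum; have [dv|vd] := leqP d v.
  rewrite r0 // big1 // => i _; rewrite mulrC -mulrA coef2XnM coef2YnM.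
  case: ifP => // _; case: ifP => // iv; rewrite coef2pb_seriesX //.
  have d0 : (0 < d)%N by have := leq_ltn_trans (leq0n i) (ltn_ord i); rewrite muln_gt0 n0.
  by have := ltn_pmod i d0; case: eqP => //; lia.
have d0 : (0 < d)%N by apply: leq_ltn_trans vd.
have i0P : (u %% n * d + v < n * d)%N by have := ltn_pmod u n0; nia.
have i0d : ((u %% n * d + v) %/ d = u %% n)%N by rewrite divnMDl // divn_small // addn0.
have i0m : ((u %% n * d + v) %% d = v)%N by rewrite modnMDl modn_small.
rewrite (bigD1 (Ordinal i0P)) // big1 ?addr0 => [|i ni].
  rewrite mulrC /basis -mulrA coef2XnM coef2YnM /= i0d i0m leqnn subnn leq_mod.
  have uE : (u - u %% n = n * (u %/ n))%N by rewrite {1}(divn_eq u n) addnK mulnC.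
  rewrite uE coef2pb_seriesX // eqxx dvdn_mulr // mulKn // cE /= i0d i0m addr0.
  by rewrite mulnC -divn_eq.
rewrite mulrC -mulrA coef2XnM coef2YnM.
case: ifP => // su; case: ifP => // tv; rewrite coef2pb_seriesX // cE eqxx.
case: ifP => // /andP[vt nu]; case/eqP: ni; apply: val_inj => /=.
rewrite {1}(divn_eq i d); have -> : (i %% d = v)%N by have := ltn_pmod i d0; lia.
have sn : (i %/ d < n)%N by rewrite ltn_divLR //.
congr (_ * _ + _)%N; move: nu; rewrite -eqn_mod_dvd // => /eqP ->.
by rewrite modn_small.
Qed.

(* The class of [(al + Y) X^m] acts on the free [C{X^n}]-module C{X,Y}/(h);   *)
(* [H] is its characteristic polynomial.                                      *)
Lemma pushforward h d : (0 < d)%N -> lexord h 0 d -> exists H w k,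
  [/\ lexord H 0 (n * d), w \is a GRing.unit, pb H = cX ^+ k * (h * w)
    & lexord (pb H) k d].
Proof.
move=> d0 ho; have N0 : (0 < n * d)%N by rewrite muln_gt0 n0.
pose y := pb cY.
have [wc wcE] := fin_all_exists (fun i : 'I_(n * d) => quotient_coordinates (y * basis i) ho).
have [C CE] := fin_all_exists wcE.
have [phi phiE] := pb_rmorphism al n0 m0.
pose CM := \matrix_(i, j) C i j.
have CMX i j : CM i j \in @seriesX R by rewrite mxE; case: (CE i).
pose H := (char_poly CM).[cY].
have H0N : H 0%N (n * d)%N = 1 by apply: char_poly_horner_coef.
pose A := map_mx phi (map_mx (horner_eval cY) (char_poly_mx CM)).
have HA : pb H = \det A by rewrite !det_map_mx phiE.
pose e : 'cV[cps2 R]_(n * d) := \col_i basis i.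
pose W : 'cV[cps2 R]_(n * d) := \col_i wc i.
(* [A] is the characteristic matrix at [pb cY], with entries of [CM] pulled back; it kills the basis
   vector up to multiples of [h]. *)
have Ae : A *m e = h *: W.
  apply/matrixP => i j; rewrite !mxE.
  have [_ /eqP] := CE i; rewrite -subr_eq => /eqP <-.
  rewrite (eq_bigr (fun k => (y *+ (i == k)) * basis k - pb (C i k) * basis k)) => [|k _]; last first.
    rewrite !mxE horner_evalE hornerD hornerN hornerMn hornerX hornerC rmorphB rmorphMn !phiE mulrBl.
    by [].
  rewrite sumrB; congr (_ - _); rewrite (bigD1 i) //= eqxx big1 ?addr0 // => k ki.
  by rewrite eq_sym (negPf ki) mul0r.
(* Multiply by the adjugate and read the entry of the basis element 1: [h] divides the
   determinant. *)
have [z pbHz] : exists z, pb H = h * z.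
  exists ((\adj A *m W) (Ordinal N0) 0).
  have : (\adj A *m (A *m e)) (Ordinal N0) 0 = h * (\adj A *m W) (Ordinal N0) 0.
    by rewrite Ae -scalemxAr mxE.
  rewrite mulmxA mul_adj_mx mul_scalar_mx mxE -HA => <-.
  by rewrite mxE /basis div0n mod0n !mulr1.
have [|B BN Ho] := @lexord0 _ H (n * d); first by rewrite H0N oner_neq0.
have [k [d' pbHo]] := lexord_ex (pb_neq0 (lexord_neq0 Ho)).
(* Squeeze: [n d' <= B <= n d] while [d <= d'] since [h] divides [pb H]. *)
have := tangential_mult_le n0 m0 nm al0 pbHo (let: And3 x _ _ := Ho in x) => ndB.
move: (pbHo); rewrite pbHz => /(lexord_Mr ho)[_ dd']; rewrite subn0 => zo.
have E1 : d' = d by nia.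
have E2 : B = (n * d)%N by nia.
subst d' B; rewrite subnn in zo; have [w zE wo] := lexord_split zo.
by exists H, w, k; split=> //; [apply/cps2_unit_lexord|rewrite pbHz zE mulrCA].
Qed.

Lemma irreducible_tangent p k d : irreducible_elt p -> lexord (pb p) k d -> (0 < d)%N ->
  lexord p 0 (n * d) /\ forall g, pb p = cX ^+ k * g -> irreducible_elt g.
Proof.
move=> pI po d0.
(* Any divisor [h] of positive order already exhausts [g] up to a unit: irreducibility follows from
   this for arbitrary [h], the order of [p] from [h = g]. *)
have key g h w e : pb p = cX ^+ k * g -> g = h * w -> lexord h 0 e -> (0 < e)%N ->
    w \is a GRing.unit /\ lexord p 0 (n * e).
  move=> pg gE ho e0; have [H [v [l [Ho vU HE Ho']]]] := pushforward e0 ho.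
  have [c pE] : divides H p.
    apply: (@divides_of_pb H p (h * v) k l (v^-1 * w) e) => //.
      by have := lexordM ho ((cps2_unit_lexord v).1 vU); rewrite !addn0.
    by rewrite pg gE -mulrA mulVKr.
  have cU : c \is a GRing.unit.
    have [_ /(_ _ _ pE)[HU|//]] := pI.
    have [_ nd0] := lexord_uniq Ho ((cps2_unit_lexord H).1 HU).
    by move/eqP: nd0; rewrite muln_eq0 !gtn_eqF.
  have pbcU : pb c \is a GRing.unit.
    apply/unitrPr; exists (pb c^-1); rewrite -pbM // divrr //; exact: pb1.
  split.
    have := @lexordM _ _ _ _ _ _ _ Ho' ((cps2_unit_lexord (pb c)).1 pbcU).
    rewrite !addn0 -pbM // -pE pg => pgo.
    have kl : k = l.
      by have [] := lexord_uniq po (_ : lexord (pb p) l e); rewrite ?pg.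
    have : cX ^+ k * (h * w) = cX ^+ k * (h * (v * pb c)).
      by rewrite -gE -pg pE pbM // HE kl; ring.
    move=> /(cps2_mulfI (lexord_neq0 (lexordX R k)))/(cps2_mulfI (lexord_neq0 ho)) ->.
    by rewrite unitrMl.
  by rewrite pE; have := lexordM Ho ((cps2_unit_lexord c).1 cU); rewrite !addn0.
have gord g : pb p = cX ^+ k * g -> lexord g 0 d.
  by move=> pg; have := po; rewrite pg => /(lexord_Mr (lexordX R k))[_ _]; rewrite subnn subn0.
split; first by have [g pg go] := lexord_split po; exact: (key g g 1 d pg (esym (mulr1 g)) go d0).2.
move=> g pg; have go := gord g pg; split=> [|a b gE].
  apply/negP => /cps2_unit_lexord gU; have [_ dz] := lexord_uniq go gU.
  by rewrite dz in d0.
have g0 := lexord_neq0 go.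
have a0 : a != 0 by apply: contraNneq g0 => a0; rewrite gE a0 mul0r.
have [i [e ao]] := lexord_ex a0.
move: (go); rewrite gE => /(lexord_Mr ao)[]; rewrite leqn0 => /eqP i0 _ _; subst i.
have [e0|e0] := posnP e; first by subst e; left; apply/cps2_unit_lexord.
by right; have [] := key g a b e pg gE ao e0.
Qed.
End Descent.

(** * Tangents of an irreducible series *)

Section PrincipalRoot.
Variable R : realType.
Local Open Scope complex_scope.

Lemma cis_polar (a : R[i]) : a != 0 ->
  exists x : R, 0 <= x < 2 * pi /\ a = (Normc.normc a)%:C * cis x.
Proof.
move=> a0; have r0 : 0 < Normc.normc a.
  by rewrite lt_neqAle normc_ge0 andbT eq_sym; apply: contraNneq a0 => /Normc.eq0_normc ->.
case: a a0 r0 => u v a0; set r := Normc.normc _ => r0.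
have r2 : r ^+ 2 = u ^+ 2 + v ^+ 2 by rewrite /r /= sqr_sqrtr // addr_ge0 ?sqr_ge0.
pose c := u / r; pose s := v / r.
have cs1 : c ^+ 2 + s ^+ 2 = 1.
  rewrite !expr_div_n -mulrDl -r2 divff // expf_neq0 //; exact: lt0r_neq0.
suff [x [x02 cx sx]] : exists x, [/\ 0 <= x < 2 * pi, cos x = c & sin x = s].
  exists x; split=> //; rewrite /cis cx sx /c /s.
  by apply/eqP; rewrite eq_complex /= !mul0r subr0 addr0 ![r * _]mulrC !divfK ?lt0r_neq0 ?eqxx.
have c1 : -1 <= c <= 1.
  by rewrite -ler_norml -(@ler_pXn2r _ 2) ?nnegrE // expr1n real_normK ?num_real //; nra.
have c1' : c \in `[-1, 1] by rewrite in_itv.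
have pi0 := pi_gt0 R.
have [s0|s0] := leP 0 s.
  exists (acos c); split; [|exact: acosK|].
    have := acos_ge0 c1; have := acos_lepi c1; lra.
  rewrite sin_acos // (_ : 1 - c ^+ 2 = s ^+ 2) ?sqrtr_sqr ?ger0_norm //; lra.
(* In this case [s < 0], so [c < 1] and [acos c > 0]: the angle stays strictly below [2 * pi]. *)
exists (2 * pi - acos c); split.
- have := acos_lepi c1; have := @acos_gt0 _ c; move=> /(_ _) H1 H2.
  have c1lt : c < 1 by nra.
  have := H1 _; rewrite c1lt; case/andP: c1 => -> _ /(_ isT); lra.
- by rewrite mulr_natl cosB cos2pi sin2pi mul1r mul0r addr0 acosK.
- rewrite mulr_natl sinB cos2pi sin2pi mul1r mul0r sub0r sin_acos //.
  by rewrite (_ : 1 - c ^+ 2 = s ^+ 2) ?sqrtr_sqr ?ltr0_norm ?opprK //; lra.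
Qed.

Lemma cisX (x : R) n : cis x ^+ n = cis (x *+ n).
Proof.
elim: n => [|n IH]; first by rewrite expr0 mulr0n /cis cos0 sin0.
rewrite exprS IH mulrS /cis cosD sinD; apply/eqP; rewrite eq_complex /= eqxx /=.
by rewrite addrC.
Qed.

Lemma principal_rootK n (a : R[i]) : (0 < n)%N -> a != 0 -> principal_root n a ^+ n = a.
Proof.
move=> n0 a0; have nR : n%:R != 0 :> R by rewrite pnatr_eq0 -lt0n.
have [_ aE] : [set x | 0 <= x < 2 * pi /\ a = (Normc.normc a)%:C * cis x] (argument a).
  exact: xgetPex (cis_polar a0).
have nE : (argument a / n%:R) *+ n = argument a by rewrite -[_ *+ n]mulr_natr divfK.
have rE : (Normc.normc a `^ n%:R^-1) ^+ n = Normc.normc a.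
  by rewrite -powR_mulrn ?powR_ge0 // -powRrM mulVf // powRr1 ?normc_ge0.
by rewrite /principal_root exprMn cisX nE -rmorphXn /= rE.
Qed.

Lemma principal_root_neq0 n (a : R[i]) : (0 < n)%N -> a != 0 -> principal_root n a != 0.
Proof.
move=> n0 a0; apply/negP => /eqP E; have := principal_rootK n0 a0.
by rewrite E expr0n gtn_eqF // => a00; rewrite -a00 eqxx in a0.
Qed.
End PrincipalRoot.

Section Tangents.
Variable R : realType.
Implicit Types f g p : cps2 R.

(** The constant term of row [k] of the pullback is the value at [al] of the part of weight [k]. *)
Lemma tangential_mult_gt0 n m (al : R[i]) f k d : lexord (pb n m al f) k d ->
  (0 < d)%N = root (wpart n m f k) al.
Proof.
move=> [f1 _ f3]; have E : (wpart n m f k).[al] = pb n m al f k 0%N.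
  by rewrite coef2pb -horner_coef0 horner_comp hornerD hornerX hornerC add0r.
rewrite rootE E; case: d f1 f3 => [/negPf -> //|d _ /(_ 0%N isT) ->]; by rewrite eqxx.
Qed.

Definition tangent_curve (t : binomial_curve R) : Prop :=
  let: (n, m, a) := t in [/\ (0 < n)%N, (0 < m)%N, coprime n m & a != 0].

Definition tpb (t : binomial_curve R) f : cps2 R :=
  let: (n, m, a) := t in pb n m (principal_root n a) f.

(* The slope of the first edge of the Newton polygon, starting from [Y^B].    *)
Lemma steepest_edge p A B : (0 < B)%N -> lexord p 0 B -> p A 0%N != 0 ->
  exists i j, [/\ (0 < i)%N, (j < B)%N, p i j != 0 &
    forall a b, p a b != 0 -> (i * B <= a * (B - j) + i * b)%N].
Proof.
move=> B0 [pB _ pj] pA.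
pose P (j : 'I_B) := `[< exists i, p i j != 0 >].
have colE (j : 'I_B) : exists i, P j -> p i j != 0 /\ forall a, p a j != 0 -> (i <= a)%N.
  case: (boolP (P j)) => [/asboolP Pj|_]; last by exists 0%N.
  by case: (ex_minnP Pj) => i pij imin; exists i.
have [col colP] := fin_all_exists colE.
(* The edge minimizes, over the columns [Y^j] below [Y^B], the lowest exponent of X divided by the
   drop [B - j]. The term [X^A] makes column 0 nonempty. *)
pose slope (j : 'I_B) : rat := (col j)%:R / (B - j)%:R.
have P0 : P (Ordinal B0) by apply/asboolP; exists A.
have [j Pj jmin] := arg_minP slope P0.
have [pij _] := colP j Pj; exists (col j), j; split=> // [|a b pab].
  by rewrite lt0n; apply: contraNneq pij => ->; rewrite pj.
have [Bb|bB] := leqP B b; first by nia.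
pose b' := Ordinal bB; have Pb : P b' by apply/asboolP; exists a.
have [_ /(_ a pab) ab] := colP b' Pb; have := jmin b' Pb.
have jB := ltn_ord j.
rewrite /slope ler_pdivrMr ?ltr0n ?subn_gt0 // mulrAC ler_pdivlMr ?ltr0n ?subn_gt0 //.
by rewrite -!natrM ler_nat /= => H; nia.
Qed.

Lemma tangent_ex p A B : (0 < B)%N -> lexord p 0 B -> p A 0%N != 0 ->
  exists t, tangent_curve t /\ exists k d, lexord (tpb t p) k d /\ (0 < d)%N.
Proof.
move=> B0 po pA; have [i [j [i0 jB pij imin]]] := steepest_edge B0 po pA.
pose g := gcdn (B - j) i; have g0 : (0 < g)%N by rewrite gcdn_gt0 i0 orbT.
pose n := ((B - j) %/ g)%N; pose m := (i %/ g)%N.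
have nE : (B - j = n * g)%N by rewrite /n divnK // dvdn_gcdl.
have mE : (i = m * g)%N by rewrite /m divnK // dvdn_gcdr.
have n0 : (0 < n)%N by rewrite divn_gt0 // dvdn_leq ?dvdn_gcdl // subn_gt0.
have m0 : (0 < m)%N by rewrite divn_gt0 // dvdn_leq ?dvdn_gcdr.
have nm : coprime n m.
  by rewrite /coprime -(eqn_pmul2r g0) muln_gcdl -nE -mE mul1n.
have wmin a b : p a b != 0 -> (m * B <= n * a + m * b)%N.
  move=> /imin; rewrite nE {1 2}mE => H; rewrite -(leq_pmul2r g0); nia.
pose F := wpart n m p (m * B).
have FB : F`_B != 0.
  by have := wpart_coef_at n0 m0 p 0 B; rewrite muln0 add0n /F => ->; case: po.
have Fj : F`_j != 0.
  rewrite /F (_ : m * B = n * i + m * j)%N ?wpart_coef_at //.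
  by have : (B = n * g + j)%N by [lia]; move=> ->; rewrite mE; nia.
have F0 : F != 0 by apply: contraNneq FB => ->; rewrite coef0.
(* [F] contains both [Y^B] and [Y^j]. After removal of its power of Y, the cofactor is not constant,
   and its roots are nonzero. *)
have [be be0 rbe] : exists2 be, be != 0 & root F be.
  have [e [Q + FE]] := multiplicity_XsubC F 0; rewrite F0 /= => Q0.
  have sQ : size Q != 1%N.
    apply/negP => /size_poly1P[c c0 QE].
    have E b : F`_b != 0 -> b = e.
      rewrite FE QE subr0 coefCM coefXn; have [-> //|_] := eqVneq b e.
      by rewrite mulr0n mulr0 eqxx.
    by have := E _ FB; rewrite -(E _ Fj) => E'; rewrite E' ltnn in jB.
  have /closed_rootP[be Qbe] := sQ.
  exists be; first by apply: contraNneq Q0 => <-.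
  by rewrite FE rootM Qbe.
pose a := be ^+ n; have a0 : a != 0 by rewrite expf_neq0.
have Fa : root F (principal_root n a).
  by apply: (wpart_root_conj n0 m0 nm (al1 := be)) => //; rewrite principal_rootK.
exists (n, m, a); split=> //.
have al0 := principal_root_neq0 n0 a0.
have [k [d ko]] := lexord_ex (pb_neq0 (principal_root n a) n0 m0 (lexord_neq0 po)).
have kE : k = (m * B)%N.
  apply/eqP; rewrite eqn_leq; apply/andP; split.
    have [pB _ _] := po; by have := pb_weight_min n0 m0 ko pB; rewrite muln0 add0n.
  have := pb_wpart_neq0 ko; rewrite -lead_coef_eq0 lead_coefE.
  by move=> /(wpart_coef_neq0 n0 m0)[a' pa' <-]; apply: wmin.
by exists k, d; split=> //; rewrite (tangential_mult_gt0 ko) kE.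
Qed.

Lemma irreducible_tangent_uniq p t k d t' k' d' : irreducible_elt p ->
  tangent_curve t -> lexord (tpb t p) k d -> (0 < d)%N ->
  tangent_curve t' -> lexord (tpb t' p) k' d' -> (0 < d')%N -> t = t'.
Proof.
case: t t' => [[n m] a] [[n' m'] a'] pI [n0 m0 nm a0] po d0 [n0' m0' nm' a0'] po' d0'.
have al0 := principal_root_neq0 n0 a0; have al0' := principal_root_neq0 n0' a0'.
have [pB _] := irreducible_tangent n0 m0 nm al0 pI po d0.
have [pB' _] := irreducible_tangent n0' m0' nm' al0' pI po' d0'.
have [_ dE] := lexord_uniq pB pB'.
have pB1 : p 0%N (n * d)%N != 0 by case: pB.
have pB1' : p 0%N (n' * d')%N != 0 by case: pB'.
have [kE [A pA AE] rootE] := tangential_mult_eq n0 m0 nm al0 po pB1.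
have [kE' [A' pA' AE'] _] := tangential_mult_eq n0' m0' nm' al0' po' pB1'.
have := pb_weight_min n0 m0 po pA'; have := pb_weight_min n0' m0' po' pA.
rewrite !muln0 !addn0 => H1 H2.
have B0 : (0 < n * d)%N by rewrite muln_gt0 n0.
(* With the common order [B], one has [n A = m B] and [n' A' = m' B]. Minimality of each weight at
   the other pure power of X, [m B <= n A'] and [m' B <= n' A], compares the slopes both ways. *)
have E : (n * m' = n' * m)%N.
  rewrite -dE in kE'; move: H1 H2 kE kE' AE AE'; move: (n * d)%N B0 => B B0 H1 H2 kE kE' AE AE'.
  have M1 : (m * B * n' <= m' * B * n)%N by nia.
  have M2 : (m' * B * n <= m * B * n')%N by nia.
  apply/eqP; rewrite -(eqn_pmul2r B0); apply/eqP; nia.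
have nn : n = n'.
  apply/eqP; rewrite eqn_dvd; apply/andP; split.
    by rewrite -(Gauss_dvdl _ nm) -E dvdn_mulr.
  by rewrite -(Gauss_dvdl _ nm') E dvdn_mulr.
subst n'; have mm : m' = m by apply/eqP; rewrite -(eqn_pmul2l n0) E.
subst m'; congr (_, _, _).
have kk : k' = k by rewrite kE kE' dE.
(* The root attached to [a'] is a root of the same lowest part, all of whose roots have n-th power
   [a]. *)
have := rootE (principal_root n a'); rewrite !principal_rootK // => -> //.
by rewrite -(tangential_mult_gt0 (al := principal_root n a') (d := d')) // -kk.
Qed.
End Tangents.

(** * Newton diagrams and quasi-tangents *)

Section NewtonGeometry.
Variable R : realType.
Variable f : cps2 R.
Local Notation point := (R^o * R^o)%type.
Local Notation D := (newton_diagram f).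

Lemma convex_setP (A : set point) : @convex_set R point A <->
  forall x y (t : R), A x -> A y -> 0 <= t -> t <= 1 ->
    A (t * x.1 + (1 - t) * y.1, t * x.2 + (1 - t) * y.2).
Proof.
split=> [cA x y t Ax Ay t0 t1|cA x y t]; last first.
  by rewrite !inE => Ax Ay; exact: (cA x y t%:num Ax Ay (ge0 t) (le1 t)).
by have := cA x y (Itv01 t0 t1); rewrite !inE => /(_ Ax Ay).
Qed.

Lemma newton_gen i j (u v : R) : f i j != 0 -> 0 <= u -> 0 <= v -> D (i%:R + u, j%:R + v).
Proof. by move=> fij u0 v0; apply: sub_gen_smallest; exists i, j, u, v. Qed.

Lemma newton_supp i j : f i j != 0 -> D (i%:R, j%:R).
Proof. by move=> fij; have := newton_gen fij (lexx 0) (lexx 0); rewrite !addr0. Qed.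

Lemma newton_convex x y (t : R) : D x -> D y -> 0 <= t -> t <= 1 ->
  D (t * x.1 + (1 - t) * y.1, t * x.2 + (1 - t) * y.2).
Proof.
move=> Dx Dy t0 t1 A [cA GA]; move/convex_setP: (cA); apply=> //.
  by apply: Dx.
by apply: Dy.
Qed.

Lemma newton_ind (A : set point) :
  (forall x y (t : R), A x -> A y -> 0 <= t -> t <= 1 ->
    A (t * x.1 + (1 - t) * y.1, t * x.2 + (1 - t) * y.2)) ->
  (forall i j (u v : R), f i j != 0 -> 0 <= u -> 0 <= v -> A (i%:R + u, j%:R + v)) ->
  D `<=` A.
Proof.
move=> cA GA; apply: smallest_sub; first exact/convex_setP.
by move=> z [i [j [u [v [fij u0 v0 ->]]]]]; exact: GA.
Qed.

Lemma newton_halfspace (u v c : R) : 0 <= u -> 0 <= v ->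
  (forall i j, f i j != 0 -> c <= u * i%:R + v * j%:R) ->
  forall z, D z -> c <= u * z.1 + v * z.2.
Proof.
move=> u0 v0 cf; apply: newton_ind => [x y t /= cx cy t0 t1|i j s r fij s0 r0 /=].
  by have t1' : 0 <= 1 - t; [lra|nra].
by have := cf i j fij; nra.
Qed.

(** The strict form serves to show that every face met here carries a monomial of [f]. *)
Lemma newton_openhalfspace (u v c : R) : 0 <= u -> 0 <= v ->
  (forall i j, f i j != 0 -> c < u * i%:R + v * j%:R) ->
  forall z, D z -> c < u * z.1 + v * z.2.
Proof.
move=> u0 v0 cf; apply: newton_ind => [x y t /= cx cy t0 t1|i j s r fij s0 r0 /=].
  have [tz|tn] := eqVneq t 0; first by subst t; lra.
  have t0' : 0 < t by rewrite lt_neqAle eq_sym tn.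
  have t1' : 0 <= 1 - t by lra.
  by nra.
by have := cf i j fij; nra.
Qed.

Lemma newton_shift z (s r : R) : D z -> 0 <= s -> 0 <= r -> D (z.1 + s, z.2 + r).
Proof.
move=> Dz s0 r0; move: z Dz.
apply: (@newton_ind [set z | D (z.1 + s, z.2 + r)]) => [x y t /= Dx Dy t0 t1|i j u v fij u0 v0 /=].
  have := newton_convex Dx Dy t0 t1 => /=.
  by congr (D (_, _)); ring.
by rewrite -!addrA; apply: newton_gen => //; rewrite addr_ge0.
Qed.

(** Without a monomial on an axis, the exponents, being integers, keep the diagram at distance at
    least 1 from it. *)
Lemma convenient_axes : f != 0 -> convenient f ->
  (exists j, f 0%N j != 0) /\ (exists i, f i 0%N != 0).
Proof.
move=> /cps2_neq0P[i [j fij]] [inf1 inf2]; have Dij := newton_supp fij.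
split; apply: contrapT => nex.
- suff : 1 <= inf [set z.1 | z in D] by rewrite inf1 ler10.
  apply: lb_le_inf; first by exists (i%:R); exists (i%:R, j%:R).
  move=> _ [z Dz <-]; have := @newton_halfspace 1 0 1 ler01 (lexx 0) _ z Dz.
  rewrite mul1r mul0r addr0; apply=> a b fab.
  rewrite mul1r mul0r addr0 (ler_nat _ 1) lt0n; apply: contra_notN nex => /eqP a0.
  by exists b; rewrite -a0.
- suff : 1 <= inf [set z.2 | z in D] by rewrite inf2 ler10.
  apply: lb_le_inf; first by exists (j%:R); exists (i%:R, j%:R).
  move=> _ [z Dz <-]; have := @newton_halfspace 0 1 1 (lexx 0) ler01 _ z Dz.
  rewrite mul1r mul0r add0r; apply=> a b fab.
  rewrite mul1r mul0r add0r (ler_nat _ 1) lt0n; apply: contra_notN nex => /eqP b0.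
  by exists a; rewrite -b0.
Qed.

Lemma finite_line (S : set point) (u v c : R) : 0 < u -> 0 < v ->
  (forall z, S z -> u * z.1 + v * z.2 = c) ->
  finite_set [set p : nat * nat | S (p.1%:R, p.2%:R)].
Proof.
move=> u0 v0 Sc; pose N := (Num.truncn (c / u)).+1; pose M := (Num.truncn (c / v)).+1.
apply: (@sub_finite_set _ _ (`I_N `*` `I_M)); last exact: finite_setX.
move=> [i j] /= /Sc /= E; have i0 : 0 <= i%:R :> R by []; have j0 : 0 <= j%:R :> R by [].
split; rewrite /= ltnS truncn_ge_nat ?ler_pdivlMr ?divr_ge0 //; nra.
Qed.

(** The diagram is stable under nonnegative translations, so a supporting normal has nonnegative
    entries; a zero entry would put a half-line into the face, against compactness. *)
Lemma compact_face (S : set point) : f != 0 -> newton_faces f S -> exists u v c : R,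
  [/\ 0 < u, 0 < v, forall z, D z -> c <= u * z.1 + v * z.2
    & S = D `&` [set z | u * z.1 + v * z.2 = c]].
Proof.
move=> /cps2_neq0P[i [j fij]] [[u [v [c [uv0 cD SE]]]] cS [p [q [Sp _ _]]]].
have ray (s r : R) : (forall t, 0 <= t -> c <= u * (i%:R + t * s) + v * (j%:R + t * r)) ->
    0 <= u * s + v * r.
  move=> H; rewrite leNgt; apply/negP => neg.
  set e := u * i%:R + v * j%:R - c; have e0 : 0 <= e.
    by have := H 0 (lexx 0); rewrite /e !mul0r !addr0; lra.
  have t0 : 0 <= (e + 1) / - (u * s + v * r) by rewrite divr_ge0 //; lra.
  have := H _ t0; set t := (_ / _).
  have : t * (u * s + v * r) = - (e + 1).
    by rewrite /t; field; rewrite lt_eqF.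
  by rewrite /e; nra.
have u0 : 0 <= u.
  have := ray 1 0; rewrite !mulr1 !mulr0 addr0; apply=> t t0.
  by have /cD := newton_gen fij t0 (lexx 0); rewrite /= mulr1 mulr0.
have v0 : 0 <= v.
  have := ray 0 1; rewrite !mulr1 !mulr0 add0r; apply=> t t0.
  by have /cD := newton_gen fij (lexx 0) t0; rewrite /= mulr1 mulr0.
have [M0 [M0r SM]] := compact_bounded cS.
have {SM} Sb z : S z -> `|z| <= M0 + 1 by apply: SM; rewrite ltrDl.
have nray (s r : R) : 0 <= s -> 0 <= r -> 1 <= s + r -> u * s + v * r = 0 -> False.
  move=> s0 r0 sr1 E; move: (Sp); rewrite SE => -[Dp pE].
  (* If the translate stayed in [S], adding the bounds [M0 + 1] on its two coordinates would give
     [t <= 2 M0 + 2 - p.1 - p.2], which is less than [t]. *)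
  pose t := 2 * `|M0| + 3 + `|p.1| + `|p.2|; have t0 : 0 <= t by rewrite !addr_ge0.
  have : S (p.1 + t * s, p.2 + t * r).
    rewrite SE; split; first by apply: newton_shift => //; rewrite mulr_ge0.
    by rewrite /= -[RHS]pE /=; nra.
  move/Sb; rewrite prod_normE ge_max /= !ler_norml => /andP[/andP[_ H1] /andP[_ H2]].
  have p1 : - `|p.1| <= p.1 by rewrite lerNl ler_normr lexx orbT.
  have p2 : - `|p.2| <= p.2 by rewrite lerNl ler_normr lexx orbT.
  have M1 : M0 <= `|M0| by rewrite ler_norm.
  have p1' : 0 <= `|p.1| by []; have p2' : 0 <= `|p.2| by [].
  have M1' : 0 <= `|M0| by [].
  have tE : t = 2 * `|M0| + 3 + `|p.1| + `|p.2| by [].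
  by have := ler_wpM2l t0 sr1; rewrite mulr1 mulrDr; lra.
exists u, v, c; split=> //; rewrite lt_neqAle eq_sym ?u0 ?v0 andbT; apply/eqP => E.
  by apply: (nray 1 0) => //; rewrite ?addr0 // E mul0r mulr0 addr0.
by apply: (nray 0 1) => //; rewrite ?add0r // E mul0r mulr0 addr0.
Qed.
End NewtonGeometry.

Section QuasiTangents.
Variable R : realType.
Variable f : cps2 R.
Local Notation point := (R^o * R^o)%type.
Local Notation D := (newton_diagram f).
Local Notation lattice S := [set p : nat * nat | S (p.1%:R : R^o, p.2%:R : R^o)].

Local Notation elems A := (finmap.enum_fset (fset_set A)).

Lemma mem_elems (A : set (nat * nat)) p : finite_set A -> (p \in elems A) = (p \in A).
Proof. by move=> finA; rewrite -(in_fset_set finA). Qed.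

Lemma line_sum n m (al : R[i]) k (A : set (nat * nat)) : (0 < n)%N -> (0 < m)%N ->
  finite_set A -> (forall p, A p -> n * p.1 + m * p.2 = k)%N ->
  (forall i j, f i j != 0 -> (n * i + m * j = k)%N -> A (i, j)) ->
  \sum_(p <- elems A) f p.1 p.2 * al ^+ p.2 = (wpart n m f k).[al].
Proof.
move=> n0 m0 finA Ak kA; rewrite -fsbig_finite //.
pose s := [seq (i, j) | i <- iota 0 k.+1, j <- iota 0 k.+1].
have sP i j : ((i, j) \in s) = (i < k.+1)%N && (j < k.+1)%N.
  apply/allpairsP/andP => [[[a b] [+ + [-> ->]]]|[ik jk]].
    by rewrite !mem_iota /=.
  by exists (i, j); rewrite !mem_iota.
have us : uniq s by apply: allpairs_uniq; rewrite ?iota_uniq // => -[a b] [a' b'].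
rewrite (eq_fsbigr (fun p => (f p.1 p.2 *+ (n * p.1 + m * p.2 == k)%N) * al ^+ p.2)); last first.
  by move=> p; rewrite inE => /Ak ->; rewrite eqxx.
rewrite (@fsbig_fwiden _ _ _ _ s) //.
- rewrite big_allpairs /wpart horner_sum -val_enum_ord big_map enumT /=.
  apply: eq_bigr => i _; rewrite horner_sum big_map; apply: eq_bigr => j _.
  by rewrite hornerZ hornerXn.
- move=> [i j] /Ak /= E; rewrite sP; apply/andP; split; nia.
- move=> [i j] /= [_ nA]; case: eqP => [E|]; last by rewrite mul0r.
  have [->|fij] := eqVneq (f i j) 0; first by rewrite mul0rn mul0r.
  by case: nA; apply: kA.
Qed.

Lemma initial_formE (S : set point) : finite_set (lattice S) -> initial_form f S =
  \sum_(p <- elems (lattice S)) (f p.1 p.2)%:P%:P * 'X^(p.1) * 'Y ^+ p.2.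
Proof. by move=> finS; rewrite /initial_form fsbig_finite. Qed.

(** Restriction to the curve [(t^n, al t^m)]: the inner variable Y becomes [al t^m], the outer
    variable X becomes [t^n]. *)
Definition curve_eval n m (al : R[i]) (P : {poly {poly R[i]}}) : {poly R[i]} :=
  (map_poly (comp_poly (al *: 'X^m)) P).['X^n].

Lemma curve_eval_binomial n m a (al : R[i]) q : al ^+ n = a ->
  curve_eval n m al (q * binomial_poly (n, m, a)) = 0.
Proof.
move=> E; rewrite /curve_eval rmorphM hornerM rmorphB rmorphM !rmorphXn /=.
rewrite !map_polyC map_polyX /= comp_polyX comp_polyC.
rewrite hornerD hornerN hornerM !horner_exp !hornerC hornerX.
by rewrite exprZn E -!exprM mulnC mul_polyC subrr mulr0.
Qed.

Lemma curve_eval_term n m (al : R[i]) c i j :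
  curve_eval n m al (c%:P%:P * 'X^i * 'Y ^+ j) = (c * al ^+ j) *: 'X^(n * i + m * j).
Proof.
rewrite /curve_eval !rmorphM !rmorphXn /= !map_polyC map_polyX /= comp_polyX comp_polyC.
rewrite !hornerM !horner_exp !hornerC hornerX exprZn -!exprM exprD.
by rewrite -!mul_polyC polyCM; ring.
Qed.

Lemma curve_eval_sum n m (al : R[i]) (I : Type) (s : seq I) (F : I -> {poly {poly R[i]}}) :
  curve_eval n m al (\sum_(x <- s) F x) = \sum_(x <- s) curve_eval n m al (F x).
Proof. by rewrite /curve_eval rmorph_sum /= horner_sum. Qed.

(* On the parametrized curve (t^n, al t^m) the factor [Y^n - a X^m] vanishes,  *)
(* so every weight contributes zero to the initial form.  If the line of [S]   *)
(* had another slope, each weight would occur at most once on it.              *)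
Lemma quasi_tangent_root n m a : f != 0 -> quasi_tangents f (n, m, a) ->
  tangent_curve (n, m, a) /\
  exists k d, lexord (pb n m (principal_root n a) f) k d /\ (0 < d)%N.
Proof.
move=> fn0 [n0 m0 nm a0 [S faceS [q IE]]]; split=> //.
have [u [v [c [u0 v0 cD SE]]]] := compact_face fn0 faceS.
have [_ _ [z0 [_ [Sz0 _ _]]]] := faceS.
have alE := principal_rootK n0 a0; have al0 := principal_root_neq0 n0 a0.
set al := principal_root n a in alE al0 *.
have Sline z : S z -> u * z.1 + v * z.2 = c by rewrite SE => -[].
have finS := finite_line u0 v0 Sline.
(* If no monomial of [f] lay on the supporting line, the whole diagram would lie in the open
   half-plane and the face would be empty. *)
have [i1 [j1 [f1 ij1]]] : exists i j, f i j != 0 /\ u * i%:R + v * j%:R = c.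
  apply: contrapT => nex; have [Dz0 z0E] : (D `&` [set z | u * z.1 + v * z.2 = c]) z0.
    by rewrite -SE.
  suff : c < u * z0.1 + v * z0.2 by rewrite z0E ltxx.
  apply: (@newton_openhalfspace _ f) => // [||i j fij]; [exact: ltW|exact: ltW|].
  rewrite lt_neqAle (cD _ (newton_supp fij)) andbT; apply/eqP => E.
  by apply: nex; exists i, j.
have inS i j : f i j != 0 -> u * i%:R + v * j%:R = c -> S (i%:R, j%:R).
  by move=> fij E; rewrite SE; split=> //; apply: newton_supp.
have sum0 : \sum_(p <- elems (lattice S))
    (f p.1 p.2 * al ^+ p.2) *: 'X^(n * p.1 + m * p.2) = 0 :> {poly R[i]}.
  have := curve_eval_binomial m q alE; rewrite -IE initial_formE // curve_eval_sum.
  by move=> E; rewrite -[RHS]E; apply: eq_bigr => p _; rewrite curve_eval_term.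
have mem1 : (i1, j1) \in elems (lattice S).
  by rewrite mem_elems // inE; apply: inS.
have slope : u * m%:R = v * n%:R.
  apply/eqP; apply: contraNT f1 => ne.
  have := congr1 (fun P : {poly R[i]} => P`_(n * i1 + m * j1)) sum0.
  rewrite coef0 coef_sum (big_rem _ mem1) /= coefZ coefXn eqxx mulr1.
  rewrite big_seq big1 ?addr0 => [/eqP|[i j]].
    by rewrite mulf_eq0 expf_eq0 (negPf al0) andbF orbF.
  rewrite mem_rem_uniq ?finmap.fset_uniq // inE => /andP[pne].
  rewrite mem_elems // inE => /Sline /= E; rewrite coefZ coefXn.
  case: eqP => [w|]; last by rewrite mulr0.
  case/eqP: pne; have /eqP := w; rewrite -(eqr_nat R) !natrD !natrM => /eqP w'.
  have E1 : u * (i%:R - i1%:R) + v * (j%:R - j1%:R) = 0.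
    by rewrite !mulrBr; lra.
  have E2 : n%:R * (i%:R - i1%:R) + m%:R * (j%:R - j1%:R) = 0 :> R.
    by rewrite !mulrBr; lra.
  have ne' : u * m%:R - v * n%:R != 0 by rewrite subr_eq0.
  have Ei : (u * m%:R - v * n%:R) * (i%:R - i1%:R) = 0 :> R.
    transitivity (m%:R * (u * (i%:R - i1%:R) + v * (j%:R - j1%:R)) -
      v * (n%:R * (i%:R - i1%:R) + m%:R * (j%:R - j1%:R))); first by ring.
    by rewrite E1 E2 !mulr0 subr0.
  have Ej : (u * m%:R - v * n%:R) * (j%:R - j1%:R) = 0 :> R.
    transitivity (u * (n%:R * (i%:R - i1%:R) + m%:R * (j%:R - j1%:R)) -
      n%:R * (u * (i%:R - i1%:R) + v * (j%:R - j1%:R))); first by ring.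
    by rewrite E1 E2 !mulr0 subr0.
  move: Ei Ej => /eqP + /eqP; rewrite !mulf_eq0 (negPf ne') /= !subr_eq0 !eqr_nat.
  by move=> /eqP -> /eqP ->.
have nR : 0 < n%:R :> R by rewrite ltr0n.
have mR : 0 < m%:R :> R by rewrite ltr0n.
have weight i j : u * i%:R + v * j%:R = u / n%:R * (n * i + m * j)%:R.
  have -> : v = u * m%:R / n%:R by rewrite slope mulfK // gt_eqF.
  by rewrite natrD !natrM; field; rewrite gt_eqF.
have un : 0 < u / n%:R by rewrite divr_gt0.
pose k := (n * i1 + m * j1)%N.
have [k0 [d fo]] := lexord_ex (pb_neq0 al n0 m0 fn0).
have kk : k0 = k.
  apply/eqP; rewrite eqn_leq (pb_weight_min n0 m0 fo f1) /=.
  have := pb_wpart_neq0 fo; rewrite -lead_coef_eq0 lead_coefE.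
  move=> /(wpart_coef_neq0 n0 m0)[i fi <-].
  have := cD _ (newton_supp fi); rewrite /= weight -ij1 weight ler_pM2l // ler_nat //.
exists k0, d; split=> //; rewrite (tangential_mult_gt0 fo) rootE kk.
rewrite -(@line_sum _ _ _ _ (lattice S) n0 m0 finS).
- have := congr1 (fun P : {poly R[i]} => P`_k) sum0; rewrite coef0 coef_sum => E.
  apply/eqP; rewrite -[RHS]E big_seq [RHS]big_seq; apply: eq_bigr => -[i j].
  rewrite mem_elems // inE => /Sline /= ij; rewrite coefZ coefXn.
  have /eqP := ij; rewrite -ij1 !weight (inj_eq (mulfI (lt0r_neq0 un))) eqr_nat => /eqP ->.
  by rewrite eqxx mulr1.
- move=> [i j] /Sline /= ij.
  by have /eqP := ij; rewrite -ij1 !weight (inj_eq (mulfI (lt0r_neq0 un))) eqr_nat => /eqP ->.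
- move=> i j fij wij; apply: inS => //.
  by rewrite -ij1 !weight wij.
Qed.

(** All monomials have the form [X^(i0 - m q) Y^(c + n q)], which is congruent to [a^q X^i0 Y^c]
    modulo [Y^n - a X^m]. The remainder is thus [X^i0 Y^c] times a scalar, which is [al^(-c)] times
    the vanishing sum. *)
Lemma initial_form_divisible n m a k (S : set point) (al : R[i]) :
  (0 < n)%N -> (0 < m)%N -> coprime n m -> al != 0 -> al ^+ n = a ->
  finite_set (lattice S) -> (forall p, lattice S p -> n * p.1 + m * p.2 = k)%N ->
  \sum_(p <- elems (lattice S)) f p.1 p.2 * al ^+ p.2 = 0 ->
  exists q, initial_form f S = q * binomial_poly (n, m, a).
Proof.
move=> n0 m0 nm al0 alE finS Sk sum0; rewrite initial_formE //; 
set s := finmap.enum_fset _ in sum0 *.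
have sk p : p \in s -> (n * p.1 + m * p.2 = k)%N by rewrite mem_elems // inE => /Sk.
have [s0|[p0 p0s]] : s = [::] \/ exists p, p \in s.
    by case: (s) => [|p t]; [left|right; exists p; rewrite mem_head].
  by exists 0; rewrite s0 big_nil mul0r.
pose c := (p0.2 %% n)%N; pose i0 := (p0.1 + m * (p0.2 %/ n))%N.
have res p : p \in s -> (p.2 = c + n * (p.2 %/ n) /\ i0 = p.1 + m * (p.2 %/ n))%N.
  move=> ps; have E1 := sk _ ps; have E2 := sk _ p0s.
  have cE : (p.2 %% n = c)%N.
    rewrite /c; wlog le : p p0 {p0s ps i0 c} E1 E2 / (p.2 <= p0.2)%N => [H|].
      by case/orP: (leq_total p.2 p0.2) => le; [exact: H|symmetry; exact: H].
    apply/esym/eqP; rewrite eqn_mod_dvd // -(Gauss_dvdr _ nm) mulnBr.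
    by rewrite (_ : _ - _ = n * (p.1 - p0.1))%N ?dvdn_mulr //; nia.
  have H1 := divn_eq p.2 n; have H2 := divn_eq p0.2 n.
  rewrite cE in H1; rewrite -/c in H2; split; first by rewrite {1}H1; lia.
  rewrite /i0; apply/eqP; rewrite -(eqn_pmul2l n0); apply/eqP; nia.
pose X1 : {poly {poly R[i]}} := a%:P%:P * 'X^m.
pose Y1 : {poly {poly R[i]}} := 'Y ^+ n.
have BE : binomial_poly (n, m, a) = Y1 - X1 by [].
pose q (p : nat * nat) := (f p.1 p.2)%:P%:P * 'X^(p.1) * 'Y ^+ c *
  \sum_(i < (p.2 %/ n)) Y1 ^+ ((p.2 %/ n).-1 - i) * X1 ^+ i.
exists (\sum_(p <- s) q p); rewrite BE.
pose M : {poly {poly R[i]}} := 'X^i0 * 'Y ^+ c.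
have termE p : p \in s -> (f p.1 p.2)%:P%:P * 'X^(p.1) * 'Y ^+ p.2 =
    q p * (Y1 - X1) + (f p.1 p.2 * a ^+ (p.2 %/ n))%:P%:P * M.
  move=> /res[E1 E2].
  have -> : 'Y ^+ p.2 = 'Y ^+ c * Y1 ^+ (p.2 %/ n) :> {poly {poly R[i]}}.
    by rewrite {1}E1 exprD exprM.
  have X1E : X1 ^+ (p.2 %/ n) = (a ^+ (p.2 %/ n))%:P%:P * 'X^(m * (p.2 %/ n)).
    by rewrite /X1 exprMn -exprM !polyC_exp.
  rewrite /q -[_ * _ * (Y1 - X1)]mulrA [_ * (Y1 - X1)]mulrC -subrXX X1E /M E2 exprD !polyCM.
  ring.
rewrite big_seq (eq_bigr _ termE) -big_seq big_split /= -!mulr_suml.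
rewrite (_ : \sum_(p <- s) (_ * a ^+ _)%:P%:P = 0) ?mul0r ?addr0 //.
rewrite -!rmorph_sum /= (_ : \sum_(p <- s) _ = 0) ?polyC0 //.
apply: (mulfI (expf_neq0 c al0)); rewrite mulr0 -[RHS]sum0 mulr_sumr.
rewrite big_seq [RHS]big_seq; apply: eq_bigr => p /res[E1 _].
have -> : al ^+ p.2 = al ^+ c * a ^+ (p.2 %/ n) by rewrite {1}E1 exprD exprM alE.
by rewrite mulrCA.
Qed.
End QuasiTangents.

Section QuasiTangentFaces.
Variable R : realType.
Variable f : cps2 R.
Local Notation point := (R^o * R^o)%type.
Local Notation D := (newton_diagram f).

Lemma compact_segment (u v b1 b2 : R) :
  compact ([set (u + v * y, y) | y in `[b1, b2]%classic] : set point).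
Proof.
have aff : continuous (fun y : R^o => (u + v * y : R^o)).
  by move=> y; apply: (@cvgD _ R^o); [exact: cvg_cst|exact: mulrl_continuous].
apply: (@continuous_compact R^o point); last exact: segment_compact.
apply: continuous_subspaceT => y; exact: (cvg_pair (aff y) cvg_id).
Qed.

Lemma root_quasi_tangent n m a k d : tangent_curve (n, m, a) ->
  lexord (pb n m (principal_root n a) f) k d -> (0 < d)%N ->
  quasi_tangents f (n, m, a).
Proof.
move=> [n0 m0 nm a0] fo d0; split=> //.
have alE := principal_rootK n0 a0; have al0 := principal_root_neq0 n0 a0.
set al := principal_root n a in alE al0 fo *.
have rF : root (wpart n m f k) al by rewrite -(tangential_mult_gt0 fo).
have F0 := pb_wpart_neq0 fo; set F := wpart n m f k in rF F0.
have Fb2 : F`_(size F).-1 != 0 by rewrite -lead_coefE lead_coef_eq0.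
set b2 := (size F).-1 in Fb2.
have [b1 Fb1 b1min] := ex_minnP (ex_intro (fun b => F`_b != 0) b2 Fb2).
have b2max b : F`_b != 0 -> (b <= b2)%N.
  move=> Fb; rewrite -ltnS /b2 -polySpred // ltnNge.
  by apply: contraNN Fb => /leq_sizeP ->.
(* A single monomial has no nonzero root; so [F] has two terms and the face is more than a point. *)
have b12 : (b1 < b2)%N.
  rewrite ltn_neqAle b2max // andbT; apply: contraTneq rF => E.
  have -> : F = F`_b2 *: 'X^b2.
    apply/polyP => b; rewrite coefZ coefXn; have [->|bb] := eqVneq b b2; first by rewrite mulr1.
    rewrite mulr0; apply/eqP/negPn/negP => Fb; case/eqP: bb.
    by apply/eqP; rewrite eqn_leq b2max //= -E b1min.
  by rewrite rootE hornerZ hornerXn mulf_neq0 // expf_neq0.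
have [a1 f1 w1] := wpart_coef_neq0 n0 m0 Fb1.
have [a2 f2 w2] := wpart_coef_neq0 n0 m0 Fb2.
have nR : 0 < n%:R :> R by rewrite ltr0n.
have mR : 0 < m%:R :> R by rewrite ltr0n.
have w1R : n%:R * a1%:R + m%:R * b1%:R = k%:R :> R by rewrite -!natrM -natrD w1.
have w2R : n%:R * a2%:R + m%:R * b2%:R = k%:R :> R by rewrite -!natrM -natrD w2.
have b12R : b1%:R < b2%:R :> R by rewrite ltr_nat.
have wmin i j : f i j != 0 -> k%:R <= n%:R * i%:R + m%:R * j%:R :> R.
  by move=> fij; rewrite -!natrM -natrD ler_nat (pb_weight_min n0 m0 fo fij).
have Dmin := newton_halfspace (ltW nR) (ltW mR) wmin.
(* The second conjunct is not convex by itself: the first one ensures that a combination of weight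
   [k] only involves points of weight [k]. *)
have Dline : D `<=` [set z : point | k%:R <= n%:R * z.1 + m%:R * z.2 /\
    (n%:R * z.1 + m%:R * z.2 = k%:R -> b1%:R <= z.2 <= b2%:R)].
  apply: newton_ind => [x y t /= [x1 x2] [y1 y2] t0 t1|i j u v fij u0 v0 /=].
    have t1' : 0 <= 1 - t by lra.
    set wx := n%:R * x.1 + m%:R * x.2 in x1 x2; set wy := n%:R * y.1 + m%:R * y.2 in y1 y2.
    have -> : n%:R * (t * x.1 + (1 - t) * y.1) + m%:R * (t * x.2 + (1 - t) * y.2) =
      t * wx + (1 - t) * wy by rewrite /wx /wy; ring.
    have xt : 0 <= t * (wx - k%:R) by rewrite mulr_ge0 ?subr_ge0.
    have yt : 0 <= (1 - t) * (wy - k%:R) by rewrite mulr_ge0 ?subr_ge0.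
    split=> [|E]; first by lra.
    have {xt} xt0 : t * (wx - k%:R) = 0 by lra.
    have {yt} yt0 : (1 - t) * (wy - k%:R) = 0 by lra.
    move: xt0 yt0 => /eqP + /eqP; rewrite !mulf_eq0 !subr_eq0 => /orP[/eqP tz|/eqP/x2/andP[x3 x4]].
      by subst t; rewrite oner_eq0 /= => /eqP/y2; rewrite !mul0r !add0r subr0 !mul1r.
    move=> /orP[/eqP tz|/eqP/y2/andP[y3 y4]].
      by subst t; rewrite subrr !mul0r !addr0 !mul1r x3.
    have := ler_wpM2l t0 x3; have := ler_wpM2l t0 x4.
    by have := ler_wpM2l t1' y3; have := ler_wpM2l t1' y4; lra.
  have wij := wmin i j fij.
  have nu : 0 <= n%:R * u by rewrite mulr_ge0 // ltW.
  have mv : 0 <= m%:R * v by rewrite mulr_ge0 // ltW.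
  split=> [|E]; first by lra.
  have mv0 : m%:R * v = 0 by lra.
  have /eqP : n%:R * i%:R + m%:R * j%:R = k%:R :> R by lra.
  rewrite -!natrM -natrD eqr_nat => /eqP kE.
  move/eqP: mv0; rewrite mulf_eq0 (gt_eqF mR) /= => /eqP ->; rewrite addr0 !ler_nat.
  have Fj : F`_j != 0 by rewrite /F -kE wpart_coef_at.
  by rewrite b1min ?b2max.
pose S : set point := D `&` [set z | n%:R * z.1 + m%:R * z.2 = k%:R].
have Sk (p : nat * nat) : S (p.1%:R, p.2%:R) -> (n * p.1 + m * p.2 = k)%N.
  move=> [_ /= /eqP]; rewrite -!natrM -natrD eqr_nat => /eqP //.
have Ssupp i j : f i j != 0 -> (n * i + m * j = k)%N -> S (i%:R, j%:R).
  move=> fij wij; split; first exact: newton_supp.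
  by rewrite /= -!natrM -natrD wij.
have finS : finite_set [set p : nat * nat | S (p.1%:R, p.2%:R)].
  by apply: (@finite_line _ S n%:R m%:R k%:R nR mR) => z [].
exists S.
  split.
  - exists n%:R, m%:R, k%:R; split=> //.
    by apply/negP => /eqP[/eqP]; rewrite gt_eqF.
  (* On the line of weight [k] the second coordinate is a parameter, and the face is the affine
     image of the segment from [b1] to [b2], hence compact. *)
  - rewrite (_ : S = [set (k%:R / n%:R + - (m%:R / n%:R) * y, y) |
        y in `[b1%:R : R, b2%:R]%classic]).
      exact: compact_segment.
    apply/seteqP; split=> [[x y] [Dz /= E]|_ [y /= + <-]].
      have [_ /(_ E) yb] := Dline _ Dz; exists y; first by rewrite /= in_itv.
      congr (_, _); rewrite -E; field; exact: lt0r_neq0.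
    rewrite in_itv /= => /andP[y1 y2].
    pose t : R := (b2%:R - y) / (b2%:R - b1%:R).
    have b0 : 0 < b2%:R - b1%:R :> R by rewrite subr_gt0.
    have t0 : 0 <= t by rewrite divr_ge0 ?subr_ge0 // ltW.
    have t1 : t <= 1 by rewrite ler_pdivrMr // mul1r; lra.
    have Dt := newton_convex (newton_supp f1) (newton_supp f2) t0 t1.
    have tb : t * b1%:R + (1 - t) * b2%:R = y.
      by rewrite /t; field; exact: lt0r_neq0.
    have nE : n%:R != 0 :> R by rewrite gt_eqF.
    have ta : t * a1%:R + (1 - t) * a2%:R = k%:R / n%:R + - (m%:R / n%:R) * y.
      have -> : a1%:R = (k%:R - m%:R * b1%:R) / n%:R :> R by rewrite -w1R; field.
      have -> : a2%:R = (k%:R - m%:R * b2%:R) / n%:R :> R by rewrite -w2R; field.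
      by rewrite -tb; field.
    rewrite /= in Dt; rewrite ta tb in Dt; split=> //=.
    by field.
  - exists (a1%:R, b1%:R), (a2%:R, b2%:R); split; [exact: Ssupp|exact: Ssupp|].
    by apply: contraTneq b12R => -[_ ->]; rewrite ltxx.
apply: (@initial_form_divisible _ f n m a k S al) => //.
by rewrite (@line_sum _ f n m al k _ n0 m0 finS) //; apply/eqP.
Qed.

Lemma quasi_tangentsP t : f != 0 -> quasi_tangents f t <->
  tangent_curve t /\ exists k d, lexord (tpb t f) k d /\ (0 < d)%N.
Proof.
case: t => [[n m] a] f0; split=> [/(quasi_tangent_root f0) //|[tc [k [d [fo d0]]]]].
exact: root_quasi_tangent fo d0.
Qed.
End QuasiTangentFaces.

(** * Strict transforms *)

Section StrictTransforms.
Variable R : realType.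
Implicit Types (f g p : cps2 R) (t : binomial_curve R).

Lemma tpb_neq0 t f : tangent_curve t -> f != 0 -> tpb t f != 0.
Proof. by case: t => [[n m] a] [n0 m0 _ _]; exact: pb_neq0. Qed.

Lemma tpbM t f g : tangent_curve t -> tpb t (f * g) = tpb t f * tpb t g.
Proof. by case: t => [[n m] a] [n0 m0 _ _]; exact: pbM. Qed.

Lemma tpb1 t : tangent_curve t -> tpb t 1 = 1.
Proof. by case: t => [[n m] a] [n0 m0 _ _]; exact: pb1. Qed.

Lemma tpb_unit t f : tangent_curve t -> f \is a GRing.unit -> tpb t f \is a GRing.unit.
Proof. by move=> tc fU; apply/unitrPr; exists (tpb t f^-1); rewrite -tpbM // divrr // tpb1. Qed.

(* Unlike [strict_transform], which asks for [k > 0], this is defined for     *)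
(* units as well, hence multiplicative.                                       *)
Definition reduced_pullback t f : cps2 R :=
  xget 0 [set g | exists k d, tpb t f = cX ^+ k * g /\ lexord g 0 d].

Lemma reduced_pullback_eq t f g k d : tpb t f = cX ^+ k * g -> lexord g 0 d ->
  reduced_pullback t f = g.
Proof.
move=> fE go; rewrite /reduced_pullback.
have /(xgetPex 0) : exists g, [set g | exists k d, tpb t f = cX ^+ k * g /\ lexord g 0 d] g.
  by exists g, k, d.
set h := xget 0 _ => -[k' [d' [hE ho]]].
have := lexordM (lexordX R k) go; rewrite -fE hE => fo.
have [kk _] := lexord_uniq (lexordM (lexordX R k') ho) fo.
rewrite !addn0 in kk; subst k'.
by apply: (@cps2_mulfI _ (cX ^+ k)); rewrite -?fE -?hE //; exact: lexord_neq0 (lexordX R k).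
Qed.

Lemma reduced_pullbackP t f k d : lexord (tpb t f) k d ->
  tpb t f = cX ^+ k * reduced_pullback t f /\ lexord (reduced_pullback t f) 0 d.
Proof. by move=> /lexord_split[g fE go]; rewrite (reduced_pullback_eq fE go). Qed.

Lemma reduced_pullback_neq0 t f : tangent_curve t -> f != 0 -> reduced_pullback t f != 0.
Proof.
by move=> tc f0; have [k [d /reduced_pullbackP[_ /lexord_neq0]]] := lexord_ex (tpb_neq0 tc f0).
Qed.

Lemma reduced_pullbackM t f g : tangent_curve t -> f != 0 -> g != 0 ->
  reduced_pullback t (f * g) = reduced_pullback t f * reduced_pullback t g.
Proof.
move=> tc f0 g0.
have [k [d /reduced_pullbackP[fE fo]]] := lexord_ex (tpb_neq0 tc f0).
have [l [e /reduced_pullbackP[gE go]]] := lexord_ex (tpb_neq0 tc g0).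
apply: (@reduced_pullback_eq _ _ _ (k + l) (d + e)); last exact: (lexordM fo go).
by rewrite tpbM // fE gE exprD mulrACA.
Qed.

Lemma reduced_pullback_unit t f : tangent_curve t -> f \is a GRing.unit ->
  reduced_pullback t f \is a GRing.unit.
Proof.
move=> tc fU; have tU := tpb_unit tc fU.
have /reduced_pullbackP[_ fo] := (cps2_unit_lexord _).1 tU.
exact/cps2_unit_lexord.
Qed.

Lemma reduced_pullback_prod t (s : seq (cps2 R)) : tangent_curve t ->
  (forall p, p \in s -> p != 0) ->
  reduced_pullback t (\prod_(p <- s) p) = \prod_(p <- s) reduced_pullback t p.
Proof.
move=> tc; elim: s => [_|p s IH s0].
  rewrite !big_nil; apply: (@reduced_pullback_eq _ _ _ 0 0).
    by rewrite tpb1 // expr0 mulr1.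
  by apply/cps2_unit_lexord; exact: unitr1.
have s0' q : q \in s -> q != 0 by move=> qs; apply: s0; rewrite inE qs orbT.
rewrite !big_cons reduced_pullbackM ?IH //; first by rewrite s0 ?mem_head.
exact: (@r0_prod R _ s id s0').1.
Qed.

Lemma strict_transformE t f : tangent_curve t -> f != 0 -> f 0%N 0%N = 0 ->
  strict_transform f t = reduced_pullback t f.
Proof.
move=> tc f0 f00.
have [k [d fo]] := lexord_ex (tpb_neq0 tc f0).
have [fE go] := reduced_pullbackP fo.
case: t tc fo fE go => [[n m] a] [n0 m0 nm a0] fo fE go.
have valX h l : fps2X R[i] ^+ l * fps2_of h = fps2_of (cX ^+ l * h).
  by rewrite -[RHS]/(val _) rmorphM rmorphXn /= val_cX.
rewrite /strict_transform; symmetry.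
have /(xgetPex 0) : exists g, is_strict_transform f (n, m, a) g.
  exists (reduced_pullback (n, m, a) f); split; last first.
    by exists d; case: go.
  exists k; last by rewrite subst_pb // valX -fE.
  (* The only monomial of weight 0 is the constant one, absent from [f]; hence [k > 0]. *)
  rewrite lt0n; apply: contraNneq (pb_wpart_neq0 fo) => k0; apply/eqP/polyP => b.
  rewrite coef0; apply/eqP/negPn/negP => /(wpart_coef_neq0 n0 m0)[a' fab].
  rewrite k0 => w0; have a'0 : a' = 0%N by [nia]; have b0 : b = 0%N by nia.
  by rewrite a'0 b0 f00 eqxx in fab.
set g := xget 0 _ => -[[l l0 gE] [j /lexord0[e _ ge]]].
apply: (@reduced_pullback_eq _ _ _ l e) => //; apply: val_inj.
by rewrite -[RHS]/(fps2_of (cX ^+ l * g)) -valX -gE subst_pb.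
Qed.

Lemma r0_eq0_unit f : f != 0 -> r0 f = 0%N -> f \is a GRing.unit.
Proof.
move=> /factorization_ex[u [s [uU sI ->]]]; rewrite r0_eq // => /size0nil ->.
by rewrite big_nil mulr1.
Qed.
End StrictTransforms.

(** * Counting the irreducible factors over their tangents *)

Section IrreducibleFactorTangent.
Variable R : realType.
Implicit Types (f g p : cps2 R) (t : binomial_curve R).

(** For irreducible [p] with pure powers of both variables, such a curve exists by [tangent_ex] and
    is unique by [irreducible_tangent_uniq], so the default value is not reached. *)
Definition factor_tangent p : binomial_curve R := xget (0%N, 0%N, 0)
  [set t | tangent_curve t /\ exists k d, lexord (tpb t p) k d /\ (0 < d)%N].

Lemma factor_tangentP p : irreducible_elt p -> (exists j, p 0%N j != 0) ->
  (exists i, p i 0%N != 0) -> tangent_curve (factor_tangent p) /\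
  forall t, tangent_curve t -> r0 (reduced_pullback t p) = (factor_tangent p == t).
Proof.
move=> pI [j /lexord0[B _ po]] [i pi0].
have B0 : (0 < B)%N.
  rewrite lt0n; apply/negP => /eqP Bz; subst B.
  by have [/negP pU _] := pI; apply: pU; apply/cps2_unit_lexord.
have /(xgetPex (0%N, 0%N, 0)) := tangent_ex B0 po pi0.
rewrite -/(factor_tangent p) => -[tc [k [d [to d0]]]]; split=> // t tc'.
have [k' [d' to']] := lexord_ex (tpb_neq0 tc' (irreducible_neq0 pI)).
have [fE go] := reduced_pullbackP to'.
have [tt|tt] := eqVneq (factor_tangent p) t.
  rewrite r0_irreducible //; move: tc' tt to' fE go.
  case: t => [[n m] a] [n0 m0 nm a0] tt to' fE _.
  have d'0 : (0 < d')%N by move: to; rewrite tt => /(lexord_uniq to')[_ ->].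
  have [_ H] := irreducible_tangent n0 m0 nm (principal_root_neq0 n0 a0) pI to' d'0.
  exact: H.
have [d'0|d'0] := posnP d'; last first.
  by rewrite (irreducible_tangent_uniq pI tc to d0 tc' to' d'0) eqxx in tt.
by subst d'; rewrite r0_unit //; apply/cps2_unit_lexord.
Qed.
End IrreducibleFactorTangent.

Theorem proposition4p7 (R : realType) (f : cps2 R)
    (f_neq0 : f != 0) (f00 : f 0%N 0%N = 0) (f_conv : convenient f) :
  r0 f = \sum_(t \in quasi_tangents f) r0 (strict_transform f t).
Proof.
have [[j fj] [i fi]] := convenient_axes f_neq0 f_conv.
have [u [s [uU sI fE]]] := factorization_ex f_neq0.
have sP p : p \in s -> exists g, f = p * g.
  by move=> ps; rewrite fE (big_rem p) //=; exists (u * \prod_(y <- rem p s) y); rewrite mulrCA.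
have tau p : p \in s -> tangent_curve (factor_tangent p) /\
    forall t, tangent_curve t -> r0 (reduced_pullback t p) = (factor_tangent p == t).
  move=> ps; have [g fpg] := sP p ps; apply: factor_tangentP; first exact: sI.
  (* A factor without a pure power of Y is divisible by X; then so is [f], which has such a
     power. *)
  - apply: contrapT => nex; have [q pE] : divides (cX ^+ 1) p.
      apply/dividesXn => -[|//] b _; apply/eqP/negPn/negP => pb.
      by apply: nex; exists b.
    by move: fj; rewrite fpg pE expr1 -mulrA coef2XM eqxx.
  - apply: contrapT => nex; have [q pE] : exists q, p = cY ^+ 1 * q.
      apply: divYn => a [|//] _; apply/eqP/negPn/negP => pa.
      by apply: nex; exists a.
    by move: fi; rewrite fpg pE expr1 -mulrA coef2YM eqxx.
have s0 p : p \in s -> p != 0 by move=> /sI/irreducible_neq0.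
have prod0 : \prod_(p <- s) p != 0 by exact: (@r0_prod R _ s id s0).1.
have r0t t : tangent_curve t ->
    r0 (reduced_pullback t f) = \sum_(p <- s) nat_of_bool (factor_tangent p == t).
  move=> tc; rewrite fE reduced_pullbackM ?(cps2_unit_neq0 uU) //.
  rewrite r0M ?reduced_pullback_neq0 ?(cps2_unit_neq0 uU) //.
  rewrite r0_unit ?reduced_pullback_unit // add0n reduced_pullback_prod //.
  have [_ ->] := @r0_prod R _ s (reduced_pullback t)
    (fun p ps => reduced_pullback_neq0 tc (s0 p ps)).
  by rewrite big_seq [RHS]big_seq; apply: eq_bigr => p ps; apply: (tau p ps).2.
(* A finite index set containing all quasi-tangents; repetitions are removed because several factors
   may share a tangent. *)
pose L := undup (map (@factor_tangent R) s).
have LP t : t \in L -> tangent_curve t.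
  by rewrite mem_undup => /mapP[p ps ->]; apply: (tau p ps).1.
have tauL p : p \in s -> factor_tangent p \in L.
  by move=> ps; rewrite mem_undup map_f.
have unit_d t k d : lexord (tpb t f) k d ->
    (reduced_pullback t f \is a GRing.unit) = (d == 0%N).
  move=> /reduced_pullbackP[_ go]; apply/idP/eqP => [/cps2_unit_lexord uo|d0].
    by have [] := lexord_uniq go uo.
  by subst d; apply/cps2_unit_lexord.
rewrite (@fsbig_fwiden _ _ _ _ L) ?undup_uniq //.
(* Double counting: each factor is counted once, at its own tangent. *)
- transitivity (\sum_(t <- L) \sum_(p <- s) nat_of_bool (factor_tangent p == t)).
    rewrite exchange_big /= fE r0_eq // -sum1_size big_seq [RHS]big_seq.
    apply: eq_bigr => p ps.
    have <- : count_mem (factor_tangent p) L = 1%N by rewrite count_uniq_mem ?undup_uniq // tauL.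
    rewrite -sum1_count big_mkcond; apply: eq_bigr => t _.
    by rewrite eq_sym /=; case: eqP.
  rewrite big_seq [RHS]big_seq; apply: eq_bigr => t /LP tc.
  by rewrite strict_transformE // r0t.
(* Outside [L] no factor contributes, so the reduced pullback would be a unit, against [d > 0]. *)
- move=> t /(quasi_tangentsP _ f_neq0)[tc [k [d [fo d0]]]] /=.
  apply: contrapT => /negP tL; move: d0; rewrite lt0n -(unit_d _ _ _ fo) => /negP; apply.
  apply: r0_eq0_unit; first exact: reduced_pullback_neq0.
  rewrite r0t // big_seq big1 // => p ps; case: eqP => // tp.
  by rewrite -tp tauL in tL.
- move=> t [/= /LP tc nq] /=; rewrite strict_transformE // r0_unit //.
  have [k [d fo]] := lexord_ex (tpb_neq0 tc f_neq0).
  rewrite (unit_d _ _ _ fo) -leqn0 leqNgt; apply/negP => d0.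
  by apply: nq; apply/quasi_tangentsP => //; split=> //; exists k, d.
Qed.
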